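(* Let $R_1>0$ and $a>0$, and let $V\in C^\infty(\mathbb{R}^2)$ be a non-negative function such that, in polar coordinates $(r,\theta)$ on $\mathbb{R}^2$, for all $r>R_1$ and all $\theta$, $$V(r,\theta)\le \frac{a}{r}\qquad\text{and}\qquad \partial_rV(r,\theta)+\frac{2}{r}V(r,\theta)\ge 0 .$$ Let $H:T^*\mathbb{R}^2\to\mathbb{R}$ be $H(q,p)=\frac12(p_1^2+p_2^2)+p_1q_2-p_2q_1-V(q)$. Fix $q_0,q_1\in\mathbb{R}^2$ with $|q_0|,|q_1|\le R_1$, and let $B(R_1)\subseteq\mathbb{R}^2$ be the closed ball of radius $R_1$ centered at the origin. Suppose that $c\in\mathbb{R}$ satisfies one of the following conditions: 1. $c>\max\left\{\sqrt[3]{32a^2},\ \sqrt{4a\left(3R_1+2\sqrt[3]{2a}\right)}\right\}$; 2. $c>\sqrt{2aR_1}$ and, additionally, $\partial_\theta V(r,\theta)=0$ for all $r\ge R_1$ and all $\theta$. Then there exists $(v,\eta)\in W^{1,2}([0,1],T^*\mathbb{R}^2)\times\mathbb{R}$ such that $$\partial_tv=\eta X_H(v),\qquad v([0,1])\subseteq H^{-1}(c),\qquad v(i)\in T^*_{q_i}\mathbb{R}^2\ \text{ for } i=0,1,$$ and $v([0,1])\subseteq T^*B(R_1)$.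
   Context: $T^*\mathbb{R}^2\cong\mathbb{R}^2\times\mathbb{R}^2$ has coordinates $(q,p)=(q_1,q_2,p_1,p_2)$ (inside the formula for $H$, $q_1,q_2$ denote the coordinates of the position $q$; elsewhere $q_0,q_1$ are the two fixed end points in $\mathbb{R}^2$). It carries the symplectic form $\omega=d\lambda$, $\lambda=p\,dq$. The Hamiltonian vector field is $X_H=\sum_i\left(\partial_{p_i}H\,\partial_{q_i}-\partial_{q_i}H\,\partial_{p_i}\right)$. For $A\subseteq\mathbb{R}^2$, $T^*A$ denotes $\{(q,p)\in T^*\mathbb{R}^2: q\in A\}$, and $T^*_{q_i}\mathbb{R}^2$ is the fiber over $q_i$. $W^{1,2}$ denotes the Sobolev space of maps with one weak derivative in $L^2$. *)

(* Defs.v *)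
From mathcomp Require Export all_boot all_order all_algebra.
From mathcomp Require Export all_classical all_reals all_analysis.

Set Implicit Arguments.
Unset Strict Implicit.
Unset Printing Implicit Defensive.

Import Order.TTheory GRing.Theory Num.Theory.
Import numFieldNormedType.Exports.

Local Open Scope classical_set_scope.
Local Open Scope ring_scope.

Section Plane.
Context {R : realType}.
Local Notation plane := 'rV[R]_2.

(* The library norm `|x| on row vectors is the sup norm. *)
Definition enorm (x : plane) : R := Num.sqrt (x 0 0 ^+ 2 + x 0 1 ^+ 2).

Definition disk (r : R) : set plane := [set x | enorm x <= r].

Definition unit_vec (i : 'I_2) : plane := delta_mx 0 i.

(* Iterated partial derivatives; the head of s is the last one taken. *)
Definition partials (s : seq 'I_2) (f : plane -> R) : plane -> R :=
  foldr (fun i g => 'D_(unit_vec i) g) f s.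

Definition smooth_plane (f : plane -> R) : Prop :=
  forall s : seq 'I_2, continuous (partials s f) /\
    forall (i : 'I_2) (x : plane), derivable (partials s f) x (unit_vec i).

Definition in_polar (f : plane -> R) (r theta : R) : R :=
  f (\row_(i < 2) (if i == 0 then r * cos theta else r * sin theta)).

Definition d_r (f : plane -> R) (r theta : R) : R :=
  derive1 (fun r' : R => in_polar f r' theta) r.

Definition d_theta (f : plane -> R) (r theta : R) : R :=
  derive1 (fun theta' : R => in_polar f r theta') theta.

Definition cbrt (x : R) : R := x `^ 3^-1.

End Plane.

Notation plane R := 'rV[R]_2.
(* Points of T^*R^2 are pairs (q, p). *)
Notation phase R := ('rV[R]_2 * 'rV[R]_2)%type.

Section Hamiltonian.
Context {R : realType}.

Definition cotangent (A : set (plane R)) : set (phase R) := [set x | A x.1].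

Definition cotangent_fiber (q : plane R) : set (phase R) := cotangent [set q].

Definition hamiltonian (V : plane R -> R) (x : phase R) : R :=
  let: (q, p) := x in
  2^-1 * (p 0 0 ^+ 2 + p 0 1 ^+ 2) + p 0 0 * q 0 1 - p 0 1 * q 0 0 - V q.

Definition ham_vf (H : phase R -> R) (x : phase R) : phase R :=
  (\row_(i < 2) 'D_((0, unit_vec i) : phase R) H x,
   \row_(i < 2) - 'D_((unit_vec i, 0) : phase R) H x).

End Hamiltonian.

Section Sobolev.
Context {R : realType}.
Local Notation mu := (@lebesgue_measure R).

Definition L2_01 (u : R -> R) : Prop :=
  (u \_ `[0, 1] : R -> R) \in Lfun mu 2%:E.

Definition test_function (phi : R -> R) : Prop :=
  (forall (n : nat) (t : R), derivable (derive1n n phi) t 1) /\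
  closure [set t | phi t != 0] `<=` `]0, 1[.

Definition weak_derivative (u w : R -> R) : Prop :=
  [/\ locally_integrable `]0, 1[ u,
      locally_integrable `]0, 1[ w &
      forall phi, test_function phi ->
        (\int[mu]_(t in `]0, 1[) (u t * derive1 phi t))%R =
        - (\int[mu]_(t in `]0, 1[) (w t * phi t))%R].

(* W^{1,2}([0,1], R): a class is represented by its unique continuous
   representative on [0,1]; values outside [0,1] are irrelevant. *)
Definition W12_01 (u : R -> R) : Prop :=
  [/\ {within `[0, 1], continuous u}, L2_01 u &
      exists w : R -> R, L2_01 w /\ weak_derivative u w].

Definition W12_phase (v : R -> phase R) : Prop :=
  forall i : 'I_2,
    W12_01 (fun t => (v t).1 0 i) /\ W12_01 (fun t => (v t).2 0 i).

Definition weak_derivative_phase (v w : R -> phase R) : Prop :=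
  forall i : 'I_2,
    weak_derivative (fun t => (v t).1 0 i) (fun t => (w t).1 0 i) /\
    weak_derivative (fun t => (v t).2 0 i) (fun t => (w t).2 0 i).

End Sobolev.

(* Main.v *)
Require Import Defs.
From mathcomp Require Import ring lra zify measurable_realfun.

(** The penalty is needed because the decay of [V] alone yields c^2 <= 2 a r at an exterior maximum
    of radius r, which is absurd only for r close to R_1. The penalty adds at least 2 a (r - R_1) to
    the left-hand side, so that c^2 <= 2 a R_1 follows at every radius; being non-negative, it
    leaves the coercivity intact.

    Discretising makes the minimisation finite-dimensional: compactness of segments is enough, and
    the limit solves Hamilton's equations classically, so no regularity theory for weak minimisers
    enters. The price is that energy is controlled only on average; two indices with energy on
    either side of c, together with conservation in the limit, recover the exact value. All limits
    are taken along one ultrafilter, which gives the limit curve at every time at once.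

    Coincident end points are treated apart: constant paths then have action tending to 0 with the
    time, so no minimiser exists, and the solution is a stationary curve with eta = 0. *)

(* The Legendre transform of [H] is the Lagrangian |q' - Aq|^2/2 + V with
   Aq = (q_2, -q_1), which is non-negative; hence for [c > 0] the free-time action
   of [L + c] is coercive and a minimiser joining q_0 to q_1 is an orbit of energy
   [c]. The minimiser is obtained as a limit of minimisers of an Euler
   discretisation, whose stationarity equations are a symplectic Euler scheme with
   mean energy [c].

   To keep the orbit in the disk, [V] is first replaced by V + M k^2, where k is
   the positive part of |q|^2 - R_1^2. At an interior maximum of |q|^2 outside the
   disk, the decay of [V], the monotonicity of r^2 V and the energy equation make
   the second derivative of |q|^2 positive as soon as c^2 > 2 a R_1, which is a
   contradiction; and the penalty vanishes to second order on the disk. Both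
   conditions on [c] imply this inequality. *)

Set Implicit Arguments.
Unset Strict Implicit.
Unset Printing Implicit Defensive.

Import Order.TTheory GRing.Theory Num.Theory.
Import numFieldNormedType.Exports.

Local Open Scope classical_set_scope.
Local Open Scope ring_scope.

(** * Limits along ultrafilters and discrete estimates *)

Lemma ultrafilter_on_nat :
  exists U : set_system nat, UltraFilter U /\ \oo `<=` U.
Proof. exact: (@ultraFilterLemma _ \oo _). Qed.

Lemma ultrafilter_fmap (S T : Type) (f : S -> T) (U : set_system S) :
  UltraFilter U -> UltraFilter (fmap f U).
Proof.
move=> UU; split=> [|G GF fUG]; first exact: fmap_proper_filter.
rewrite predeqE => A; split; last exact: fUG.
move=> GA; have [//|UnA] := in_ultra_setVsetC (f @^-1` A) UU.
have GnA : G (~` A) by apply: fUG.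
by have /filter_ex [? []] : G (A `&` ~` A) by exact: filterI.
Qed.

(** This replaces the extraction of subsequences: the same [U] serves for every bounded sequence, in
    particular for uncountably many times simultaneously. *)
Lemma ultrafilter_bounded_cvg (R : realType) (U : set_system nat)
    (UU : UltraFilter U) (u : nat -> R) (C : R) :
  (\forall n \near U, `|u n| <= C) -> exists l : R, u @ U --> l.
Proof.
move=> uC; have := @segment_compact R (- C) C.
rewrite compact_ultra => /(_ (u @ U) _)[].
- exact: ultrafilter_fmap.
- have : U [set n | `|u n| <= C] by exact: uC.
  apply: (@filterS _ U) => n /=; rewrite in_itv/= ler_norml //.
- by move=> l [_ ul]; exists l.
Qed.

(** Since (1 + k)^j <= exp (j k), the growth depends on the elapsed time [j%:R * k] only, which
    keeps later bounds uniform in the number of steps. *)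
Lemma discrete_gronwall (R : realType) (a s : nat -> R) (k : R) (n : nat) :
  0 <= k -> 0 <= a 0 -> (forall i, 0 <= s i) ->
  (forall i, (i < n)%N -> a i.+1 <= (1 + k) * (a i + s i)) ->
  forall j, (j <= n)%N ->
    a j <= expR (j%:R * k) * (a 0 + \sum_(0 <= i < j) s i).
Proof.
move=> k0 a0 s0 H; elim=> [|j IH] jn.
  by rewrite mul0r expR0 big_nil addr0 mul1r.
apply: (le_trans (H _ jn)).
have S0 : 0 <= \sum_(0 <= i < j) s i by apply: sumr_ge0.
set X := expR (j%:R * k); have X1 : 1 <= X by rewrite -expR0 ler_expR mulr_ge0.
have -> : expR (j.+1%:R * k) = expR k * X by rewrite -natr1 mulrDl mul1r expRD mulrC.
rewrite big_nat_recr//=; set S := \sum_(0 <= i < j) s i in S0 IH *.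
have aS : a j + s j <= X * (a 0 + (S + s j)).
  rewrite addrA [leRHS]mulrDr lerD//; first by apply: IH; lia.
  by rewrite ler_peMl.
apply: (le_trans (ler_wpM2l _ aS)); first by lra.
rewrite -mulrA ler_wpM2r ?expR_ge1Dx//.
by rewrite mulr_ge0 ?expR_ge0// addr_ge0// addr_ge0.
Qed.

(** A discrete mean value inequality. With [gam = 0] it gives Lipschitz bounds; with [gam] the limit
    of the slopes it gives the derivative of the limit curve. *)
Lemma increments_close (R : realType) (z g : nat -> R) (h eps gam : R) (i j : nat) :
  0 <= h -> (i <= j)%N ->
  (forall k, (i <= k < j)%N -> z k.+1 - z k = h * g k) ->
  (forall k, (i <= k < j)%N -> `|g k - gam| <= eps) ->
  `|z j - z i - (j - i)%:R * h * gam| <= (j - i)%:R * h * eps.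
Proof.
move=> h0; elim: j => [|j IH] ij zg ge.
  have -> : i = 0%N by lia.
  by rewrite !subnn !mul0r subrr subr0 normr0.
have [->|] := eqVneq i j.+1; first by rewrite !subnn !mul0r subrr subr0 normr0.
move=> ne; have ij' : (i <= j)%N by lia.
have -> : z j.+1 - z i - (j.+1 - i)%:R * h * gam =
  (z j - z i - (j - i)%:R * h * gam) + h * (g j - gam).
  have := zg j; rewrite ij' ltnSn => /(_ isT) e.
  rewrite subSn// -natr1 mulrBr -e; ring.
apply: (le_trans (ler_normD _ _)).
rewrite subSn// -natr1 !mulrDl mul1r lerD//.
  by apply: IH => // k kk; [apply: zg|apply: ge]; lia.
by rewrite normrM ger0_norm// ler_wpM2l// ge// ij' ltnSn.
Qed.

(** * Derivatives in one real variable *)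

Section RealDerivatives.
Context {R : realType}.
Implicit Types (f g : R -> R) (t a b : R).

Lemma is_derive_cvg f t a :
  is_derive t 1 f a <-> h^-1 * (f (h + t) - f t) @[h --> 0^'] --> a.
Proof.
have E : (fun h => h^-1 *: (f (h *: (1 : R) + t) - f t)) =
         (fun h : R => h^-1 * (f (h + t) - f t)).
  by apply/funext => h; rewrite /GRing.scale /= mulr1.
split.
  by move=> [+ <-]; rewrite /derivable /derive E.
move=> H; apply: DeriveDef; rewrite /derivable /derive E.
  by apply/cvg_ex; exists a.
exact: cvg_lim.
Qed.

(* Eta-expanded forms of the library rules for [is_derive], which unify with
   lambda terms. *)
Lemma derD f g t a b : is_derive t 1 f a -> is_derive t 1 g b ->
  is_derive t 1 (fun s => f s + g s) (a + b).
Proof. by move=> fa gb; exact: is_deriveD. Qed.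

Lemma derB f g t a b : is_derive t 1 f a -> is_derive t 1 g b ->
  is_derive t 1 (fun s => f s - g s) (a - b).
Proof. by move=> fa gb; exact: is_deriveB. Qed.

Lemma derM f g t a b : is_derive t 1 f a -> is_derive t 1 g b ->
  is_derive t 1 (fun s => f s * g s) (a * g t + f t * b).
Proof.
by move=> fa gb; apply: is_derive_eq; rewrite addrC /GRing.scale/= [a * _]mulrC.
Qed.

Lemma derC (c : R) t : is_derive t 1 (fun _ => c) 0.
Proof. exact: is_derive_cst. Qed.

Lemma derI t : is_derive t 1 (fun s : R => s) 1.
Proof. exact: is_derive_id. Qed.

Lemma derX2 f t a : is_derive t 1 f a ->
  is_derive t 1 (fun s => f s ^+ 2) (2 * f t * a).
Proof.
move=> fa; have -> : 2 * f t * a = a * f t + f t * a by ring.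
have -> : (fun s => f s ^+ 2) = (fun s => f s * f s).
  by apply/funext => s; rewrite expr2.
exact: derM.
Qed.

Lemma der_continuous f t a : is_derive t 1 f a -> {for t, continuous f}.
Proof.
by move=> [fd _]; apply/differentiable_continuous; rewrite -derivable1_diffP.
Qed.

Lemma der_min0 f t a : is_derive t 1 f a ->
  (forall s, derivable f s 1) -> (\forall s \near t, f t <= f s) -> a = 0.
Proof.
move=> fa fd /nbhs_ballP[e /= e0 H].
have D0 : is_derive t 1 f 0.
  apply: (@derive1_at_min R f (t - e) (t + e) t).
  - by lra.
  - by move=> s _; exact: fd.
  - by rewrite in_itv/=; lra.
  - move=> s; rewrite in_itv/= => /andP[s1 s2]; apply: H.
    by rewrite /ball/= ltr_norml; apply/andP; split; lra.
by have [_ <-] := fa; have [_ ->] := D0.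
Qed.

End RealDerivatives.

(** * Functions of two variables *)

Section TwoVariables.
Context {R : realType}.
Implicit Types (W : R -> R -> R).

Definition joint_continuous W := continuous (fun z : R * R => W z.1 z.2).

Lemma joint_cvg (T : Type) (F : set_system T) (FF : Filter F) W
    (f g : T -> R) (x y : R) :
  joint_continuous W -> f @ F --> x -> g @ F --> y ->
  W (f t) (g t) @[t --> F] --> W x y.
Proof.
move=> cW fx gy.
exact: (@continuous2_cvg _ _ _ _ F FF f g W x y (cW (x, y)) fx gy).
Qed.

Lemma joint_bounded W (C : R) : joint_continuous W ->
  exists B : R, 0 <= B /\
    forall x y, `|x| <= C -> `|y| <= C -> `|W x y| <= B.
Proof.
move=> cW; have cK := compact_setX (@segment_compact R (- C) C) (@segment_compact R (- C) C).
have := @continuous_compact _ _ (fun z : R * R => W z.1 z.2) _ _ cK.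
move=> /(_ (continuous_subspaceT cW)) /compact_bounded [M [_ MB]].
exists (Num.max 0 (M + 1)); split; first by rewrite le_max lexx.
move=> x y xC yC; rewrite le_max; apply/orP; right.
apply: (MB (M + 1)); first by rewrite ltrDl.
exists (x, y) => //; split; rewrite /= in_itv/= -ler_norml //.
Qed.

(** Locating [xi] by a distance instead of an interval treats both orders of [a] and [b] at once and
    makes [xi] tend to [a] with [b]. *)
Lemma mean_value (f df : R -> R) (a b : R) :
  (forall x : R, is_derive x 1 f (df x)) ->
  exists xi, `|xi - a| <= `|b - a| /\ f b - f a = df xi * (b - a).
Proof.
move=> fd.
have fc x y : {within `[x, y], continuous f}.
  by apply: continuous_subspaceT => z; exact: der_continuous (fd z).
have [ab|ba] := leP a b.
  have [xi] := MVT_segment ab (fun x _ => fd x) (fc _ _).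
  rewrite in_itv/= => /andP[? ?] e; exists xi; split=> //.
  by rewrite !ger0_norm; lra.
have [xi] := MVT_segment (ltW ba) (fun x _ => fd x) (fc _ _).
rewrite in_itv/= => /andP[? ?] e; exists xi; split; last by lra.
by rewrite !ler0_norm; lra.
Qed.

(** The increment is split into a horizontal and a vertical one, each given by the mean value
    theorem. The intermediate points are squeezed to [x t] and [y t], so continuity of the partial
    derivatives replaces total differentiability. *)
Lemma chain_rule2 W W1 W2 (x y : R -> R) (t a b : R) :
  joint_continuous W1 -> joint_continuous W2 ->
  (forall u v : R, is_derive u 1 (W ^~ v) (W1 u v)) ->
  (forall u v : R, is_derive v 1 (W u) (W2 u v)) ->
  is_derive t 1 x a -> is_derive t 1 y b ->
  is_derive t 1 (fun s => W (x s) (y s)) (W1 (x t) (y t) * a + W2 (x t) (y t) * b).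
Proof.
move=> c1 c2 d1 d2 xa yb.
have /choice[xi xiP] h : exists xi, `|xi - x t| <= `|x (h + t) - x t| /\
    W (x (h + t)) (y (h + t)) - W (x t) (y (h + t)) =
    W1 xi (y (h + t)) * (x (h + t) - x t).
  exact: (@mean_value (W ^~ (y (h + t))) (W1 ^~ (y (h + t))) (x t)
    (x (h + t)) (fun u => d1 u _)).
have /choice[et etP] h : exists et, `|et - y t| <= `|y (h + t) - y t| /\
    W (x t) (y (h + t)) - W (x t) (y t) = W2 (x t) et * (y (h + t) - y t).
  exact: (@mean_value (W (x t)) (W2 (x t)) (y t) (y (h + t)) (fun u => d2 _ u)).
have shift (f : R -> R) c : is_derive t 1 f c -> f (h + t) @[h --> 0^'] --> f t.
  move=> fc; apply: (cvg_comp (fun h : R => h + t) f); last exact: der_continuous fc.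
  have : (h + t) @[h --> 0^'] --> 0 + t by apply: cvgD; [exact: nbhs_dnbhs|exact: cvg_cst].
  by rewrite add0r.
have squeeze (f g : R -> R) : f (h + t) @[h --> 0^'] --> f t ->
    (forall h, `|g h - f t| <= `|f (h + t) - f t|) -> g h @[h --> 0^'] --> f t.
  move=> fc gf; apply/cvgrPdist_le => e e0.
  have /cvgrPdist_le/(_ e e0) := fc; apply: filterS => h.
  by rewrite ![`|f t - _|]distrC; apply: le_trans.
apply/is_derive_cvg.
under eq_fun => h.
  have -> : h^-1 * (W (x (h + t)) (y (h + t)) - W (x t) (y t)) =
    W1 (xi h) (y (h + t)) * (h^-1 * (x (h + t) - x t)) +
    W2 (x t) (et h) * (h^-1 * (y (h + t) - y t)).
    have [_ e1] := xiP h; have [_ e2] := etP h.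
    rewrite mulrCA -e1 mulrCA -e2; ring.
  over.
apply: cvgD; apply: cvgM.
- apply: joint_cvg => //; last exact: shift yb.
  by apply: squeeze (shift _ _ xa) _ => h; have [] := xiP h.
- exact/is_derive_cvg.
- apply: joint_cvg => //; first exact: cvg_cst.
  by apply: squeeze (shift _ _ yb) _ => h; have [] := etP h.
- exact/is_derive_cvg.
Qed.

End TwoVariables.

(** * The discrete free-time action *)

Lemma der_sum (R : realType) (f : nat -> R -> R) (df : nat -> R) (t : R) n :
  (forall j, is_derive t 1 (f j) (df j)) ->
  is_derive t 1 (fun s => \sum_(0 <= j < n) f j s) (\sum_(0 <= j < n) df j).
Proof.
move=> fd; elim: n => [|n IH].
  rewrite big_nil; under eq_fun do rewrite big_nil; exact: derC.
rewrite big_nat_recr//=; under eq_fun do rewrite big_nat_recr//=.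
exact: derD.
Qed.

Lemma sum_delta (R : realType) (F : nat -> R) (i n : nat) : (i < n)%N ->
  \sum_(0 <= j < n) F j * (j == i)%:R = F i.
Proof.
move=> ni; rewrite big_mkord (bigD1 (Ordinal ni))//= eqxx mulr1 big1 ?addr0// => j.
by rewrite -val_eqE/= => /negbTE ->; rewrite mulr0.
Qed.

Section DiscreteAction.
Context {R : realType} (W : R -> R -> R) (c a1 a2 b1 b2 : R).

(* Discrete counterparts of the momentum p = q' - Aq with Aq = (q_2, -q_1). *)
Definition mom1 (h : R) (x y : nat -> R) (j : nat) : R := (x j.+1 - x j) / h - y j.
Definition mom2 (h : R) (x y : nat -> R) (j : nat) : R := (y j.+1 - y j) / h + x j.

(** The step [h] is an unknown like the vertices, so the total time [n%:R * h] is free. Sampling the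
    position at the left end of each step is what makes the stationarity equations a symplectic
    Euler scheme. *)
Definition action (n : nat) (h : R) (x y : nat -> R) : R :=
  \sum_(0 <= j < n)
    h * ((mom1 h x y j ^+ 2 + mom2 h x y j ^+ 2) / 2 + W (x j) (y j) + c).

Definition admissible (n : nat) (h : R) (x y : nat -> R) : Prop :=
  [/\ 0 < h, x 0 = a1, y 0 = a2, x n = b1 & y n = b2].

(** Completing squares, this is ((p + y)^2 + (q - x)^2 - x^2 - y^2) / 2 - W; momenta are bounded,
    and chosen, through that form. *)
Definition energy (x y p q : R) : R :=
  (p ^+ 2 + q ^+ 2) / 2 + p * y - q * x - W x y.

Hypothesis cW : joint_continuous W.
Hypothesis W_ge0 : forall u v, 0 <= W u v.
Hypothesis c_gt0 : 0 < c.

(** The competitor is the straight segment run in total time 1. What matters is that [K] does not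
    depend on [n], so it bounds the minimal action under refinement. *)
Lemma linear_path_action :
  exists K : R, 0 <= K /\ forall n, exists h x y,
    admissible n.+1 h x y /\ action n.+1 h x y <= K.
Proof.
pose M : R := `|a1| + `|a2| + `|b1| + `|b2|.
have [B [B0 BP]] := joint_bounded M cW.
(* Both momenta are at most 2 M in absolute value, hence the kinetic term is at most 4 M^2; [B]
   bounds [W] on the square of half-side [M]. *)
exists (4 * M ^+ 2 + B + c); split.
  by have := sqr_ge0 M; move: (M ^+ 2) B0 c_gt0 => m; lra.
move=> n; pose h : R := n.+1%:R^-1.
have n0 : 0 < n.+1%:R :> R by rewrite ltr0n.
have h0 : 0 < h by rewrite invr_gt0.
pose l (a b : R) (j : nat) := a + j%:R * h * (b - a).
have lS a b j : (l a b j.+1 - l a b j) / h = b - a.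
  rewrite /l -natr1; field; exact/lt0r_neq0.
have lM (a b : R) j : (j <= n.+1)%N -> `|l a b j| <= Num.max `|a| `|b|.
  move=> jn; have : 0 <= j%:R * h <= 1.
    apply/andP; split; first by rewrite mulr_ge0// ltW.
    by rewrite /h ler_pdivrMr// mul1r ler_nat.
  rewrite /l; move: (j%:R * h) => u /andP[u0 u1].
  have -> : a + u * (b - a) = (1 - u) * a + u * b by ring.
  apply: (le_trans (ler_normD _ _)); rewrite !normrM (ger0_norm u0) ger0_norm ?subr_ge0//.
  have aM : `|a| <= Num.max `|a| `|b| by rewrite le_max lexx.
  have bM : `|b| <= Num.max `|a| `|b| by rewrite le_max lexx orbT.
  have := ler_wpM2l u0 bM; have := @ler_wpM2l _ (1 - u) _ _ _ aM.
  by rewrite subr_ge0 => /(_ u1); lra.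
have M1 : Num.max `|a1| `|b1| <= M.
  by rewrite ge_max; have := normr_ge0 a1; have := normr_ge0 a2;
     have := normr_ge0 b1; have := normr_ge0 b2; rewrite /M => *; apply/andP; split; lra.
have M2 : Num.max `|a2| `|b2| <= M.
  by rewrite ge_max; have := normr_ge0 a1; have := normr_ge0 a2;
     have := normr_ge0 b1; have := normr_ge0 b2; rewrite /M => *; apply/andP; split; lra.
exists h, (l a1 b1), (l a2 b2); split.
  by split=> //; rewrite /l ?mul0r ?addr0// mulfV ?lt0r_neq0//; ring.
have sqM (u : R) : `|u| <= 2 * M -> u ^+ 2 <= 4 * M ^+ 2.
  move=> uM; rewrite -real_normK ?num_real//.
  have -> : 4 * M ^+ 2 = (2 * M) ^+ 2 by ring.
  by rewrite lerXn2r// nnegrE// (le_trans (normr_ge0 u)).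
have step j : (j < n.+1)%N -> h * ((mom1 h (l a1 b1) (l a2 b2) j ^+ 2 +
    mom2 h (l a1 b1) (l a2 b2) j ^+ 2) / 2 + W (l a1 b1 j) (l a2 b2 j) + c) <=
    h * (4 * M ^+ 2 + B + c).
  move=> jn; rewrite ler_pM2l// /mom1 /mom2 !lS.
  have x1 := le_trans (lM a1 b1 j (ltnW jn)) M1.
  have x2 := le_trans (lM a2 b2 j (ltnW jn)) M2.
  have WB := le_trans (ler_norm _) (BP _ _ x1 x2).
  have /sqM s1 : `|b1 - a1 - l a2 b2 j| <= 2 * M.
    have := ler_normB (b1 - a1) (l a2 b2 j); have := ler_normB b1 a1.
    have := normr_ge0 a2; have := normr_ge0 b2; move: x2; rewrite /M; lra.
  have /sqM s2 : `|b2 - a2 + l a1 b1 j| <= 2 * M.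
    have := ler_normD (b2 - a2) (l a1 b1 j); have := ler_normB b2 a2.
    have := normr_ge0 a1; have := normr_ge0 b1; move: x1; rewrite /M; lra.
  lra.
rewrite /action; apply: (@le_trans _ _ (\sum_(0 <= j < n.+1) h * (4 * M ^+ 2 + B + c))).
  by apply: ler_sum_nat => j /andP[_ jn]; exact: step.
rewrite sumr_const_nat subn0 -[h * _ *+ _]mulr_natl mulrA /h mulfV ?mul1r//; exact: lt0r_neq0.
Qed.


(** The L^1 norm of q' - Aq: it is the length up to the rotation term, and enters the Gronwall
    estimate as the source. *)
Definition path_length (n : nat) (h : R) (x y : nat -> R) : R :=
  \sum_(0 <= j < n) h * (`|mom1 h x y j| + `|mom2 h x y j|).

Lemma term_ge0 h x y j : 0 < h ->
  0 <= h * ((mom1 h x y j ^+ 2 + mom2 h x y j ^+ 2) / 2 + W (x j) (y j) + c).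
Proof.
move=> h0; apply: mulr_ge0; first exact: ltW.
apply: addr_ge0; last exact: ltW.
by apply: addr_ge0 => //; rewrite divr_ge0// addr_ge0// sqr_ge0.
Qed.

Lemma action_time n h x y : 0 < h -> n%:R * h <= action n h x y / c.
Proof.
move=> h0; rewrite ler_pdivlMr// /action.
apply: (@le_trans _ _ (\sum_(0 <= j < n) h * c)).
  by rewrite sumr_const_nat subn0 -[h * _ *+ _]mulr_natl mulrA.
apply: ler_sum => j _; rewrite ler_pM2l// lerDr addr_ge0//.
by rewrite divr_ge0// addr_ge0// sqr_ge0.
Qed.

(* Young's inequality with a free parameter [k]: small [k] bounds the time
   from below, [k = 1] bounds the path. *)
Lemma path_length_le n h x y k : 0 < h -> 0 < k ->
  path_length n h x y <= n%:R * h / (2 * k) + 2 * k * action n h x y.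
Proof.
move=> h0 k0.
have young (u : R) : `|u| <= 1 / (4 * k) + k * u ^+ 2.
  have -> : 1 / (4 * k) + k * u ^+ 2 = (1 + (2 * k * `|u|) ^+ 2) / (4 * k).
    by rewrite exprMn real_normK ?num_real//; field; exact: lt0r_neq0.
  rewrite ler_pdivlMr ?mulr_gt0//.
  by have := sqr_ge0 (2 * k * `|u| - 1); rewrite sqrrB expr1n mulr1; lra.
have -> : n%:R * h / (2 * k) = \sum_(0 <= j < n) h / (2 * k).
  by rewrite sumr_const_nat subn0 -[h / _ *+ _]mulr_natl mulrA.
rewrite /path_length /action mulr_sumr -big_split/=; apply: ler_sum => j _.
have y1 := young (mom1 h x y j); have y2 := young (mom2 h x y j).
have -> : h / (2 * k) = h * (1 / (4 * k) + 1 / (4 * k)).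
  by field; rewrite lt0r_neq0.
rewrite mulrCA -mulrDr ler_pM2l//.
have := W_ge0 (x j) (y j); move: (W _ _) => w w0.
have : 0 <= k * w by apply: mulr_ge0 => //; exact: ltW.
have : 0 <= k * c by apply: mulr_ge0; exact: ltW.
move: (1 / (4 * k)) y1 y2 => k' y1 y2 *; nra.
Qed.

Lemma mom1P h x y j : 0 < h -> x j.+1 = x j + h * (mom1 h x y j + y j).
Proof. by move=> h0; rewrite /mom1; field; rewrite lt0r_neq0. Qed.

Lemma mom2P h x y j : 0 < h -> y j.+1 = y j + h * (mom2 h x y j - x j).
Proof. by move=> h0; rewrite /mom2; field; rewrite lt0r_neq0. Qed.

(** The time is bounded above because each unit of it costs at least [c], and positions are bounded
    by Gronwall, since the rotation field is linear. The time is bounded below because the path has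
    to cover the distance [d] between the end points; this keeps the step of a minimising sequence
    away from 0. *)
Lemma a_priori_bounds (K : R) : 0 <= K -> 0 < `|b1 - a1| + `|b2 - a2| ->
  exists C T0 : R, [/\ 0 <= C, 0 < T0 & forall n h x y,
    admissible n h x y -> action n h x y <= K ->
    [/\ T0 <= n%:R * h, n%:R * h <= K / c &
      forall j, (j <= n)%N -> `|x j| <= C /\ `|y j| <= C]].
Proof.
move=> K0; have [d dE] : exists d : R, d = `|b1 - a1| + `|b2 - a2| by eexists.
rewrite -dE => d0.
(* The last summand bounds [path_length] through [path_length_le] with [k = 1]. *)
pose C : R := expR (K / c) * (`|a1| + `|a2| + (K / c / 2 + 2 * K)).
(* Chosen so that 2 k K <= d / 2: the action then accounts for at most half of the distance, and the
   other half must be paid for by time. *)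
pose k : R := d / (4 * (K + 1)).
have Kc : 0 <= K / c by rewrite divr_ge0// ltW.
have C0 : 0 <= C by rewrite mulr_ge0 ?expR_ge0// !addr_ge0//; lra.
have k0 : 0 < k by rewrite /k divr_gt0// mulr_gt0// ltr_wpDl.
have kC : 0 < 1 / (2 * k) + 2 * C.
  by apply: ltr_wpDr; [rewrite mulr_ge0|rewrite divr_gt0// mulr_gt0].
exists C, (d / 2 / (1 / (2 * k) + 2 * C)); split=> //; first by rewrite !divr_gt0.
move=> n h x y [h0 x0 y0 xn yn] SK.
have T1 : n%:R * h <= K / c.
  by apply: (le_trans (action_time n x y h0)); rewrite ler_pM2r ?invr_gt0.
have T0 : 0 <= n%:R * h by rewrite mulr_ge0// ltW.
have step j : `|x j.+1| + `|y j.+1| <=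
    (1 + h) * ((`|x j| + `|y j|) + h * (`|mom1 h x y j| + `|mom2 h x y j|)).
  rewrite (mom1P x y j h0) (mom2P x y j h0).
  have h1 := ltW h0.
  have e1 := ler_normD (x j) (h * (mom1 h x y j + y j)).
  have e2 := ler_normD (y j) (h * (mom2 h x y j - x j)).
  have := ler_wpM2l h1 (ler_normD (mom1 h x y j) (y j)).
  have := ler_wpM2l h1 (ler_normB (mom2 h x y j) (x j)).
  rewrite !normrM (ger0_norm h1) in e1 e2.
  have := normr_ge0 (mom1 h x y j); have := normr_ge0 (mom2 h x y j).
  move: e1 e2; move: `|mom1 _ _ _ _| `|mom2 _ _ _ _| `|x j| `|y j| => P Q X Y.
  move: `|_ + _| `|_ + _| `|_ + _| `|_ - _| => A1 A2 A3 A4 *.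
  have : 0 <= h * h * (P + Q) by rewrite !mulr_ge0// addr_ge0.
  by lra.
have bound j : (j <= n)%N -> `|x j| + `|y j| <= C.
  move=> jn.
  have := @discrete_gronwall R (fun j => `|x j| + `|y j|)
    (fun j => h * (`|mom1 h x y j| + `|mom2 h x y j|)) h n
    (ltW h0) _ _ (fun i _ => step i) j jn.
  rewrite x0 y0 => H; apply: (le_trans (H _ _)).
  - by rewrite addr_ge0.
  - by move=> i; rewrite mulr_ge0 ?(ltW h0)// addr_ge0.
  have Lj : \sum_(0 <= i < j) h * (`|mom1 h x y i| + `|mom2 h x y i|) <= path_length n h x y.
    rewrite /path_length [leRHS](@big_cat_nat _ _ _ j)//= lerDl sumr_ge0// => i _.
    by rewrite mulr_ge0 ?(ltW h0)// addr_ge0.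
  have L1 := @path_length_le n h x y 1 h0 ltr01.
  apply: ler_pM; rewrite ?expR_ge0//.
  - by rewrite addr_ge0 ?addr_ge0// sumr_ge0// => i _; rewrite mulr_ge0 ?(ltW h0)// addr_ge0.
  - rewrite ler_expR (le_trans _ T1)// ler_pM2r// ler_nat//.
  - rewrite lerD2l; apply: (le_trans Lj); apply: (le_trans L1).
    by rewrite mulr1; lra.
split=> //; last first.
  by move=> j /bound; have := normr_ge0 (x j); have := normr_ge0 (y j); lra.
rewrite ler_pdivrMr//.
have Lk := @path_length_le n h x y k h0 k0.
have dL : d <= path_length n h x y + n%:R * h * (2 * C).
  have tel (z : nat -> R) : z n - z 0 = \sum_(0 <= j < n) (z j.+1 - z j).
    by rewrite telescope_sumr.
  rewrite dE -xn -x0 -yn -y0 !tel.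
  have -> : n%:R * h * (2 * C) = \sum_(0 <= j < n) h * (2 * C).
    by rewrite sumr_const_nat subn0 -mulrA [LHS]mulr_natl.
  apply: (le_trans (lerD (ler_norm_sum _ _ _) (ler_norm_sum _ _ _))).
  rewrite /path_length -!big_split/=; apply: ler_sum_nat => j /andP[_ jn].
  have -> : x j.+1 - x j = h * (mom1 h x y j + y j) by rewrite {1}(mom1P x y j h0); ring.
  have -> : y j.+1 - y j = h * (mom2 h x y j - x j) by rewrite {1}(mom2P x y j h0); ring.
  rewrite !normrM (gtr0_norm h0) -!mulrDr ler_pM2l//.
  have := ler_normD (mom1 h x y j) (y j); have := ler_normB (mom2 h x y j) (x j).
  by have := bound j (ltnW jn); lra.
have kK : 2 * k * K <= d / 2.
  rewrite /k; have -> : 2 * (d / (4 * (K + 1))) * K = d / 2 * (K / (K + 1)).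
    by field; rewrite lt0r_neq0//; lra.
  rewrite ler_piMr//; first by lra.
  by rewrite ler_pdivrMr; lra.
have : 2 * k * action n h x y <= 2 * k * K by rewrite ler_pM2l// mulr_gt0.
have -> : n%:R * h * (1 / (2 * k) + 2 * C) = n%:R * h / (2 * k) + n%:R * h * (2 * C).
  by rewrite mul1r mulrDr.
move: kK dL Lk; set A1 := _ * h / _; set A2 := _ * h * _; set A3 := 2 * k * K.
move: A1 A2 A3 (2 * k * _) (path_length _ _ _ _) => A1 A2 A3 A4 A5; move: (d) => d'; lra.
Qed.

End DiscreteAction.

(** * Discrete minimisers and their stationarity equations *)

Section Minimizer.
Context {R : realType} (W W1 W2 : R -> R -> R) (c a1 a2 b1 b2 : R).

Hypothesis cW : joint_continuous W.
Hypothesis cW1 : joint_continuous W1.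
Hypothesis cW2 : joint_continuous W2.
Hypothesis dW1 : forall u v : R, is_derive u 1 (W ^~ v) (W1 u v).
Hypothesis dW2 : forall u v : R, is_derive v 1 (W u) (W2 u v).
Hypothesis W_ge0 : forall u v, 0 <= W u v.
Hypothesis c_gt0 : 0 < c.

Lemma action_cvg (U : set_system nat) (UU : ProperFilter U) n
    (hs : nat -> R) (xs ys : nat -> nat -> R) (h : R) (x y : nat -> R) :
  h != 0 -> hs @ U --> h ->
  (forall j, (j <= n)%N -> xs k j @[k --> U] --> x j) ->
  (forall j, (j <= n)%N -> ys k j @[k --> U] --> y j) ->
  action W c n (hs k) (xs k) (ys k) @[k --> U] --> action W c n h x y.
Proof.
move=> h0 hsh xsx ysy.
have H m : (m <= n)%N ->
    action W c m (hs k) (xs k) (ys k) @[k --> U] --> action W c m h x y.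
  elim: m => [_|m IH mn].
    rewrite /action big_nil; under eq_fun do rewrite big_nil; exact: cvg_cst.
  rewrite /action big_nat_recr//=; under eq_fun do rewrite big_nat_recr//=.
  apply: cvgD; first by apply: IH; exact: ltnW.
  have xm := xsx _ (ltnW mn); have ym := ysy _ (ltnW mn).
  have xm' := xsx _ mn; have ym' := ysy _ mn.
  have hV : (hs k)^-1 @[k --> U] --> h^-1 by exact: cvgV.
  have P : mom1 (hs k) (xs k) (ys k) m @[k --> U] --> mom1 h x y m.
    by apply: cvgB => //; apply: cvgM => //; apply: cvgB.
  have Q : mom2 (hs k) (xs k) (ys k) m @[k --> U] --> mom2 h x y m.
    by apply: cvgD => //; apply: cvgM => //; apply: cvgB.
  apply: cvgM => //; apply: cvgD; last exact: cvg_cst.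
  apply: cvgD; last exact: joint_cvg.
  apply: cvgM; last exact: cvg_cst.
  apply: cvgD.
    by rewrite expr2; under eq_fun do rewrite expr2; exact: cvgM.
  by rewrite expr2; under eq_fun do rewrite expr2; exact: cvgM.
exact: H.
Qed.

Definition minimizing n h x y :=
  admissible a1 a2 b1 b2 n h x y /\
  forall h' x' y', admissible a1 a2 b1 b2 n h' x' y' ->
    action W c n h x y <= action W c n h' x' y'.

(** The direct method for fixed [n]: step and vertices of a minimising sequence are bounded, hence
    converge along an ultrafilter. The lower bound on the time makes the limiting step positive, so
    that the limit is admissible and the action continuous there. *)
Lemma minimizer_exists n : 0 < `|b1 - a1| + `|b2 - a2| ->
  exists h x y, minimizing n.+1 h x y.
Proof.
move=> d0.
pose adm (u : R * (nat -> R) * (nat -> R)) :=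
  admissible a1 a2 b1 b2 n.+1 u.1.1 u.1.2 u.2.
pose act (u : R * (nat -> R) * (nat -> R)) := action W c n.+1 u.1.1 u.1.2 u.2.
pose E := act @` [set u | adm u].
have E0 : E !=set0.
  have [K [_ /(_ n)[h [x [y [a _]]]]]] := linear_path_action a1 a2 b1 b2 cW c_gt0.
  by exists (act (h, x, y)), (h, x, y).
have act0 u : adm u -> 0 <= act u.
  by move=> [h0 *]; apply: sumr_ge0 => j _; exact: term_ge0.
have Elb : lbound E 0 by move=> _ [u /act0 ? <-].
have lbE : has_lbound E by exists 0.
have m0 : 0 <= inf E by exact: lb_le_inf.
have /choice[u uP] k : exists u, adm u /\ act u < inf E + k.+1%:R^-1.
  have [|_ [u au <-] ulim] := @inf_adherent _ E k.+1%:R^-1 _ (conj E0 lbE).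
    by rewrite invr_gt0.
  by exists u.
have K0 : 0 <= inf E + 1 by rewrite addr_ge0.
have [C [T0 [C0 T00 bounds]]] := a_priori_bounds W_ge0 c_gt0 K0 d0.
have ub k : [/\ T0 <= n.+1%:R * (u k).1.1, n.+1%:R * (u k).1.1 <= (inf E + 1) / c &
    forall j, (j <= n.+1)%N -> `|(u k).1.2 j| <= C /\ `|(u k).2 j| <= C].
  have [ak ek] := uP k; apply: bounds => //; apply: (le_trans (ltW ek)).
  by rewrite lerD2l invf_le1// ler1n.
have [U [UU ooU]] := ultrafilter_on_nat.
have near_all (P : nat -> Prop) : (forall k, P k) -> \forall k \near U, P k.
  by move=> HP; exact: nearW.
have [h hlim] : exists h : R, (u k).1.1 @[k --> U] --> h.
  apply: (@ultrafilter_bounded_cvg _ U UU (fun k => (u k).1.1) ((inf E + 1) / c)).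
  apply: near_all => k.
  have [[h0 _ _ _ _] _] := uP k; have [_ + _] := ub k.
  rewrite gtr0_norm//; apply: le_trans.
  by rewrite ler_peMl ?(ltW h0)// ler1n.
(* Vertices beyond [n.+1] do not enter the action; their limits are set to 0. *)
have /choice[x xlim] j : exists l : R, (j <= n.+1)%N -> (u k).1.2 j @[k --> U] --> l.
  have [jn|] := boolP (j <= n.+1)%N; last by exists 0.
  have [|l ll] := @ultrafilter_bounded_cvg _ U UU (fun k => (u k).1.2 j) C; last by exists l.
  by apply: near_all => k; have [_ _ /(_ j jn)[]] := ub k.
have /choice[y ylim] j : exists l : R, (j <= n.+1)%N -> (u k).2 j @[k --> U] --> l.
  have [jn|] := boolP (j <= n.+1)%N; last by exists 0.
  have [|l ll] := @ultrafilter_bounded_cvg _ U UU (fun k => (u k).2 j) C; last by exists l.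
  by apply: near_all => k; have [_ _ /(_ j jn)[]] := ub k.
have h0 : 0 < h.
  apply: (@lt_le_trans _ _ (T0 / n.+1%:R)); first by rewrite divr_gt0.
  apply: (cvgr_to_ge hlim); apply: near_all => k.
  by rewrite ler_pdivrMr// mulrC; have [] := ub k.
have const (f : nat -> R) l b : f @ U --> l -> (forall k, f k = b) -> l = b.
  move=> fl fb; apply/eqP; rewrite eq_le; apply/andP; split.
    by apply: (cvgr_to_le fl); apply: near_all => k; rewrite fb.
  by apply: (cvgr_to_ge fl); apply: near_all => k; rewrite fb.
have adm_lim : admissible a1 a2 b1 b2 n.+1 h x y.
  split => //.
  - by apply: (const _ _ _ (xlim 0%N _)) => // k; have [[_ ? ? ? ?] _] := uP k.
  - by apply: (const _ _ _ (ylim 0%N _)) => // k; have [[_ ? ? ? ?] _] := uP k.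
  - by apply: (const _ _ _ (xlim n.+1 _)) => // k; have [[_ ? ? ? ?] _] := uP k.
  - by apply: (const _ _ _ (ylim n.+1 _)) => // k; have [[_ ? ? ? ?] _] := uP k.
exists h, x, y; split=> // h' x' y' a'.
apply: (@le_trans _ _ (inf E)); last first.
  by apply: ge_inf => //; exists (h', x', y').
have cv : act (u k) @[k --> U] --> action W c n.+1 h x y.
  by apply: action_cvg => //; exact: lt0r_neq0.
apply/ler_addgt0Pr => e e0; apply: (cvgr_to_le cv).
have : \oo [set k | @harmonic R k < e].
  by have /cvgr_lt := @cvg_harmonic R; apply.
move=> /ooU; apply: filterS => k /= ke.
have [_ ak] := uP k; apply: ltW; apply: (lt_trans ak); rewrite ltrD2l.
exact: ke.
Qed.

Section EulerLagrange.
Variables (n : nat) (h : R) (x y : nat -> R).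
Hypothesis min_xy : minimizing n h x y.
Let h0 : 0 < h. Proof. by have [[]] := min_xy. Qed.

(** The derivative at 0 of the action along [x + s xi], [y + s eta], which stay admissible because
    the variation vanishes at both ends. *)
Lemma action_variation (xi eta : nat -> R) :
  xi 0 = 0 -> eta 0 = 0 -> xi n = 0 -> eta n = 0 ->
  \sum_(0 <= j < n)
    (mom1 h x y j * (xi j.+1 - xi j - h * eta j) +
     mom2 h x y j * (eta j.+1 - eta j + h * xi j) +
     h * (W1 (x j) (y j) * xi j + W2 (x j) (y j) * eta j)) = 0.
Proof.
move=> xi0 eta0 xin etan.
pose X (s : R) j : R := x j + s * xi j; pose Y (s : R) j : R := y j + s * eta j.
have dl (f g s : R) : is_derive s 1 (fun s => f + s * g) g.
  by apply: is_derive_eq (derD (derC f s) (derM (derI s) (derC g s))) _; ring.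
have dX j (s : R) : is_derive s 1 (X ^~ j) (xi j) := dl (x j) (xi j) s.
have dY j (s : R) : is_derive s 1 (Y ^~ j) (eta j) := dl (y j) (eta j) s.
pose D (s : R) j : R := mom1 h (X s) (Y s) j * (xi j.+1 - xi j - h * eta j) +
     mom2 h (X s) (Y s) j * (eta j.+1 - eta j + h * xi j) +
     h * (W1 (X s j) (Y s j) * xi j + W2 (X s j) (Y s j) * eta j).
have dA (s : R) : is_derive s 1 (fun s => action W c n h (X s) (Y s))
    (\sum_(0 <= j < n) D s j).
  apply: der_sum => j.
  have dP : is_derive s 1 (fun s => mom1 h (X s) (Y s) j) ((xi j.+1 - xi j) / h - eta j).
    apply: derB (dY j s).
    apply: is_derive_eq (derM (derB (dX j.+1 s) (dX j s)) (derC h^-1 s)) _.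
    by rewrite mulr0 addr0.
  have dQ : is_derive s 1 (fun s => mom2 h (X s) (Y s) j) ((eta j.+1 - eta j) / h + xi j).
    apply: derD (dX j s).
    apply: is_derive_eq (derM (derB (dY j.+1 s) (dY j s)) (derC h^-1 s)) _.
    by rewrite mulr0 addr0.
  have dW := @chain_rule2 R W W1 W2 (X ^~ j) (Y ^~ j) s _ _ cW1 cW2 dW1 dW2
     (dX j s) (dY j s).
  have H := derM (derC h s) (derD (derD
    (derM (derD (derX2 dP) (derX2 dQ)) (derC 2^-1 s)) dW) (derC c s)).
  apply: (is_derive_eq H); rewrite /D.
  by field; rewrite lt0r_neq0.
have X0 : X 0 = x by apply/funext => j; rewrite /X mul0r addr0.
have Y0 : Y 0 = y by apply/funext => j; rewrite /Y mul0r addr0.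
have := dA 0; rewrite /D X0 Y0 => /der_min0; apply.
- by move=> s; have [] := dA s.
apply: (@nearW _ (nbhs (0 : R))) => s; rewrite X0 Y0; have [[_ x0 y0 xn yn] mxy] := min_xy.
by apply: mxy; split=> //; rewrite /X /Y ?xi0 ?eta0 ?xin ?etan mulr0 addr0.
Qed.

(** The variation is a unit bump at the interior vertex [i.+1], which affects only the steps [i] and
    [i.+1]. *)
Lemma euler_lagrange1 i : (i.+1 < n)%N ->
  mom1 h x y i.+1 - mom1 h x y i = h * (mom2 h x y i.+1 + W1 (x i.+1) (y i.+1)).
Proof.
move=> iN; have := @action_variation (fun j => (j == i.+1)%:R) (fun=> 0).
rewrite (gtn_eqF iN) => /(_ erefl erefl erefl erefl).
under eq_bigr => j _.
  have -> : mom1 h x y j * ((j.+1 == i.+1)%:R - (j == i.+1)%:R - h * 0) +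
     mom2 h x y j * (0 - 0 + h * (j == i.+1)%:R) +
     h * (W1 (x j) (y j) * (j == i.+1)%:R + W2 (x j) (y j) * 0) =
     mom1 h x y j * (j == i)%:R +
     (h * (mom2 h x y j + W1 (x j) (y j)) - mom1 h x y j) * (j == i.+1)%:R.
    by rewrite eqSS; ring.
  over.
by rewrite big_split/= !sum_delta// ?(ltnW iN)//; lra.
Qed.

Lemma euler_lagrange2 i : (i.+1 < n)%N ->
  mom2 h x y i.+1 - mom2 h x y i = h * (- mom1 h x y i.+1 + W2 (x i.+1) (y i.+1)).
Proof.
move=> iN; have := @action_variation (fun=> 0) (fun j => (j == i.+1)%:R).
rewrite (gtn_eqF iN) => /(_ erefl erefl erefl erefl).
under eq_bigr => j _.
  have -> : mom1 h x y j * (0 - 0 - h * (j == i.+1)%:R) +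
     mom2 h x y j * ((j.+1 == i.+1)%:R - (j == i.+1)%:R + h * 0) +
     h * (W1 (x j) (y j) * 0 + W2 (x j) (y j) * (j == i.+1)%:R) =
     mom2 h x y j * (j == i)%:R +
     (h * (- mom1 h x y j + W2 (x j) (y j)) - mom2 h x y j) * (j == i.+1)%:R.
    by rewrite eqSS; ring.
  over.
by rewrite big_split/= !sum_delta// ?(ltnW iN)//; lra.
Qed.

(* The step is varied as [expR t * h], which is positive for every [t]. *)
Lemma mean_energy :
  \sum_(0 <= j < n) (energy W (x j) (y j) (mom1 h x y j) (mom2 h x y j) - c) = 0.
Proof.
pose s (t : R) : R := expR t * h.
have s0 (t : R) : 0 < s t by rewrite mulr_gt0 ?expR_gt0.
(* The derivative of h (L + c) in [h], with the vertices fixed, is L + c - q' L_{q'}, that is [c]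
   minus the energy; the factor [s t] comes from the exponential. *)
pose D (t : R) j : R := - s t *
  (energy W (x j) (y j) (mom1 (s t) x y j) (mom2 (s t) x y j) - c).
have dA (t : R) : is_derive t 1 (fun t => action W c n (s t) x y) (\sum_(0 <= j < n) D t j).
  apply: der_sum => j.
  have ds : is_derive t 1 s (s t).
    have -> : s t = expR t * h + expR t * 0 by rewrite mulr0 addr0.
    exact: derM.
  have dV : is_derive t 1 (fun t => (s t)^-1) (- (s t)^-1).
    have -> : (fun t => (s t)^-1) = (fun t => expR (- t) * h^-1).
      by apply/funext => u; rewrite /s invfM expRN.
    have dN : is_derive t 1 (fun u => expR (- u)) (- expR (- t)).
      have -> : - expR (- t) = expR (- t) * (-1) by ring.
      apply: (@is_derive1_comp _ expR -%R t).
    apply: is_derive_eq (derM dN (derC h^-1 t)) _.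
    by rewrite /s invfM expRN; ring.
  have dP : is_derive t 1 (fun t => mom1 (s t) x y j) (- ((x j.+1 - x j) / s t)).
    apply: is_derive_eq (derB (derM (derC (x j.+1 - x j) t) dV) (derC (y j) t)) _.
    by ring.
  have dQ : is_derive t 1 (fun t => mom2 (s t) x y j) (- ((y j.+1 - y j) / s t)).
    apply: is_derive_eq (derD (derM (derC (y j.+1 - y j) t) dV) (derC (x j) t)) _.
    by ring.
  have H := derM ds (derD (derD
    (derM (derD (derX2 dP) (derX2 dQ)) (derC 2^-1 t))
    (derC (W (x j) (y j)) t)) (derC c t)).
  apply: (is_derive_eq H); rewrite /D /energy /mom1 /mom2.
  by field; rewrite lt0r_neq0.
have s00 : s 0 = h by rewrite /s expR0 mul1r.
have : \sum_(0 <= j < n) D 0 j = 0.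
  apply: (der_min0 (dA 0)); first by move=> t; have [] := dA t.
  apply: (@nearW _ (nbhs (0 : R))) => t; rewrite s00; have [[_ x0 y0 xn yn] mxy] := min_xy.
  by apply: mxy; split.
rewrite /D s00 -mulr_sumr => /eqP; rewrite mulf_eq0 oppr_eq0 (gt_eqF h0)/=.
by move=> /eqP.
Qed.

End EulerLagrange.
End Minimizer.

(** * Discrete orbits with bounds uniform in the number of steps *)

Section DiscreteSolutions.
Context {R : realType} (W W1 W2 : R -> R -> R) (c a1 a2 b1 b2 : R).

(** There are [n.+1] steps, and [p j], [q j] belong to the step from [j] to [j.+1]. The scheme does
    not conserve energy; the two indices in the last clause are what remains of the mean energy
    identity. *)
Definition symplectic_euler (n : nat) (h C : R) (x y p q : nat -> R) : Prop :=
  [/\ [/\ 0 < h, x 0 = a1, y 0 = a2, x n.+1 = b1 & y n.+1 = b2],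
      forall j, (j <= n)%N ->
        [/\ `|x j| <= C, `|y j| <= C, `|p j| <= C & `|q j| <= C],
      forall j, (j <= n)%N ->
        x j.+1 - x j = h * (p j + y j) /\ y j.+1 - y j = h * (q j - x j),
      forall j, (j < n)%N ->
        p j.+1 - p j = h * (q j.+1 + W1 (x j.+1) (y j.+1)) /\
        q j.+1 - q j = h * (- p j.+1 + W2 (x j.+1) (y j.+1)) &
      (exists2 j, (j <= n)%N & energy W (x j) (y j) (p j) (q j) <= c) /\
      (exists2 j, (j <= n)%N & c <= energy W (x j) (y j) (p j) (q j))].

Lemma sum0_le0 (F : nat -> R) n : \sum_(0 <= j < n.+1) F j = 0 ->
  exists2 j, (j <= n)%N & F j <= 0.
Proof.
move=> F0; apply: contrapT => H.
have Fp j : (j < n.+1)%N -> 0 < F j.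
  by move=> jn; rewrite ltNge; apply/negP => Fj; apply: H; exists j.
have : 0 < \sum_(0 <= j < n.+1) F j.
  rewrite big_nat_recl//= ltr_pwDl ?Fp//.
  by rewrite big_nat; apply: sumr_ge0 => j /andP[_ jn]; apply/ltW/Fp.
by rewrite F0 ltxx.
Qed.

Hypothesis cW : joint_continuous W.
Hypothesis cW1 : joint_continuous W1.
Hypothesis cW2 : joint_continuous W2.
Hypothesis dW1 : forall u v : R, is_derive u 1 (W ^~ v) (W1 u v).
Hypothesis dW2 : forall u v : R, is_derive v 1 (W u) (W2 u v).
Hypothesis W_ge0 : forall u v, 0 <= W u v.
Hypothesis c_gt0 : 0 < c.

(** The action controls momenta only in the mean. A pointwise bound starts at an index where the
    energy is at most [c] and is propagated from there in both directions by Gronwall. The condition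
    on [n] makes [h <= 1 / 2], as the momentum equations are implicit. *)
Lemma discrete_solutions : 0 < `|b1 - a1| + `|b2 - a2| ->
  exists C T : R, [/\ 0 <= C, 0 <= T & forall n, 2 * T <= n.+1%:R ->
    exists h x y p q, n.+1%:R * h <= T /\ symplectic_euler n h C x y p q].
Proof.
move=> d0.
have [K [K0 HK]] := linear_path_action a1 a2 b1 b2 cW c_gt0.
have [C [T0 [C0 _ bounds]]] := a_priori_bounds W_ge0 c_gt0 K0 d0.
have [B0 [B00 WB]] := joint_bounded C cW.
have [B1 [B10 W1B]] := joint_bounded C cW1.
have [B2 [B20 W2B]] := joint_bounded C cW2.
have [T TE] : exists T : R, T = K / c by eexists.
have T00 : 0 <= T by rewrite TE divr_ge0// ltW.
(* [A] bounds [|p| + |q|] where the energy is at most [c]: there (p + y)^2 + (q - x)^2 <= 2 (c + C^2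
   + B0), and |u| <= (1 + u^2) / 2. *)
have [A AE] : exists A : R, A = 2 * C + 1 + 2 * (c + C ^+ 2 + B0) by eexists.
have A0 : 0 <= A by have := sqr_ge0 C; rewrite AE; move: (C ^+ 2) c_gt0 => C2; lra.
have [G GE] : exists G : R, G = expR (2 * T) * (A + T * (B1 + B2)) by eexists.
have G0 : 0 <= G.
  by rewrite GE mulr_ge0 ?expR_ge0// addr_ge0// mulr_ge0// addr_ge0.
exists (Num.max C G), T; split=> //; first by rewrite le_max C0.
move=> n nT.
have [h [x [y mxy]]] := minimizer_exists cW W_ge0 c_gt0 n d0.
have [adm mact] := mxy; have [h0 x0 y0 xn yn] := adm.
have [|_ hT xyC] := bounds n.+1 h x y adm.
  have [h' [x' [y' [adm' /(le_trans _)]]]] := HK n; apply; exact: mact.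
rewrite -TE in hT.
have h12 : h <= 1 / 2.
  have n0 : 0 < n.+1%:R :> R by rewrite ltr0n.
  by rewrite -(ler_pM2l n0); lra.
pose p := mom1 h x y; pose q := mom2 h x y.
have EL j : (j < n)%N ->
    p j.+1 - p j = h * (q j.+1 + W1 (x j.+1) (y j.+1)) /\
    q j.+1 - q j = h * (- p j.+1 + W2 (x j.+1) (y j.+1)).
  move=> jn; split.
    exact: (euler_lagrange1 cW1 cW2 dW1 dW2 mxy).
  exact: (euler_lagrange2 cW1 cW2 dW1 dW2 mxy).
have ME := mean_energy mxy.
have [j0 j0n Ej0] : exists2 j, (j <= n)%N & energy W (x j) (y j) (p j) (q j) <= c.
  by have [j jn Ej] := sum0_le0 ME; exists j => //; move: Ej; rewrite subr_le0.
have [j1 j1n Ej1] : exists2 j, (j <= n)%N & c <= energy W (x j) (y j) (p j) (q j).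
  have [|j jn Ej] := @sum0_le0 (fun j => c - energy W (x j) (y j) (p j) (q j)) n.
    apply/eqP; rewrite -oppr_eq0 -sumrN; apply/eqP; rewrite -[RHS]ME.
    by apply: eq_bigr => j _; rewrite opprB.
  by exists j => //; move: Ej; rewrite subr_le0.
have pqA : `|p j0| + `|q j0| <= A.
  have [xC yC] := xyC j0 (leqW j0n).
  have := le_trans (ler_norm _) (WB _ _ xC yC).
  have sq (u : R) : `|u| <= C -> u ^+ 2 <= C ^+ 2.
    by move=> uC; rewrite -real_normK ?num_real// lerXn2r// nnegrE.
  have := sq _ xC; have := sq _ yC.
  have am (u : R) : `|u| <= (1 + u ^+ 2) / 2.
    by have := sqr_ge0 (`|u| - 1); rewrite sqrrB expr1n real_normK ?num_real// mulr1; lra.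
  have := am (p j0 + y j0); have := am (q j0 - x j0).
  have := ler_normB (p j0 + y j0) (y j0); rewrite addrK.
  have := ler_normD (q j0 - x j0) (x j0); rewrite subrK.
  have := sqr_ge0 C; move: Ej0; rewrite /energy AE.
  move: xC yC; move: (W _ _) => w; move: (C ^+ 2) (x j0) (y j0) (p j0) (q j0) c_gt0 B00.
  move=> C2 X Y P Q *; lra.
pose N j : R := `|p j| + `|q j|; pose s : R := h * (B1 + B2).
have N0 j : 0 <= N j by rewrite addr_ge0.
have s0 : 0 <= s by rewrite mulr_ge0 ?(ltW h0)// addr_ge0.
(* Forwards the equations only give (1 - h) N_{j+1} <= N_j + s; since (1 + 2 h) (1 - h) >= 1 for
   [h <= 1 / 2], the factor 1 + 2 h works in both directions. *)
have step j : (j < n)%N ->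
    N j.+1 <= (1 + 2 * h) * (N j + s) /\ N j <= (1 + 2 * h) * (N j.+1 + s).
  move=> jn; have [e1 e2] := EL j jn.
  have [xC yC] := xyC j.+1 (leqW jn).
  have b1' := W1B _ _ xC yC; have b2' := W2B _ _ xC yC.
  have d1 : `|p j.+1 - p j| <= h * (`|q j.+1| + B1).
    rewrite e1 normrM gtr0_norm// ler_pM2l//.
    by apply: (le_trans (ler_normD _ _)); rewrite lerD2l.
  have d2 : `|q j.+1 - q j| <= h * (`|p j.+1| + B2).
    rewrite e2 normrM gtr0_norm// ler_pM2l//.
    by apply: (le_trans (ler_normD _ _)); rewrite normrN lerD2l.
  have t1 : `|p j.+1| <= `|p j| + `|p j.+1 - p j|.
    by have := ler_normD (p j) (p j.+1 - p j); rewrite addrC subrK.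
  have t2 : `|q j.+1| <= `|q j| + `|q j.+1 - q j|.
    by have := ler_normD (q j) (q j.+1 - q j); rewrite addrC subrK.
  have t3 : `|p j| <= `|p j.+1| + `|p j.+1 - p j|.
    by have := ler_normB (p j.+1) (p j.+1 - p j); rewrite opprB addrC subrK.
  have t4 : `|q j| <= `|q j.+1| + `|q j.+1 - q j|.
    by have := ler_normB (q j.+1) (q j.+1 - q j); rewrite opprB addrC subrK.
  have n0 := N0 j; have n1 := N0 j.+1; rewrite /N /s in n0 n1 *.
  move: d1 d2 t1 t2 t3 t4 n0 n1 h0 h12 B10 B20; clear.
  move: `|p j| `|q j| `|p j.+1| `|q j.+1| `|_ - _| `|_ - _|.
  move=> P Q P' Q' D1 D2 d1 d2 t1 t2 t3 t4 n0 n1 h0 h12 B10 B20.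
  have hB : 0 <= h * h * (B1 + B2) by rewrite !mulr_ge0 ?(ltW h0)// addr_ge0.
  split; last first.
    have : 0 <= h * (P' + Q') by rewrite mulr_ge0// ltW.
    lra.
  have u : (1 - h) * (P' + Q') <= P + Q + h * (B1 + B2) by lra.
  have : (1 + 2 * h) * ((1 - h) * (P' + Q')) <= (1 + 2 * h) * (P + Q + h * (B1 + B2)).
    by rewrite ler_pM2l//; lra.
  apply: le_trans.
  have : 0 <= h * (1 - 2 * h) * (P' + Q') by rewrite !mulr_ge0//; lra.
  lra.
have hn k : (k <= n)%N -> k%:R * h <= T.
  move=> kn; apply: le_trans hT; rewrite ler_pM2r// ler_nat; exact: leqW.
have chain (a : nat -> R) m : (m <= n)%N -> a 0%N <= A -> (forall i, 0 <= a i) ->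
    (forall i, (i < m)%N -> a i.+1 <= (1 + 2 * h) * (a i + s)) -> a m <= G.
  move=> mn aA a0 am.
  have h20 : 0 <= 2 * h by lra.
  have := discrete_gronwall h20 (a0 0%N) (fun=> s0) am (leqnn m).
  move=> /le_trans; apply; rewrite GE; apply: ler_pM; rewrite ?expR_ge0//.
  - by rewrite addr_ge0// sumr_ge0.
  - by rewrite ler_expR; have := hn _ mn; lra.
  - rewrite lerD// sumr_const_nat subn0 -[s *+ _]mulr_natl /s mulrA.
    by rewrite ler_wpM2r ?addr_ge0// hn.
have bound j : (j <= n)%N -> N j <= G.
  move=> jn; have [jj|jj] := leqP j0 j.
    have := chain (fun i => N (j0 + i)%N) (j - j0)%N.
    rewrite /= addn0 subnKC//; apply; rewrite ?(leq_trans (leq_subr _ _))//.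
    move=> i ij; rewrite addnS; apply: (proj1 (step _ _)).
    by apply: leq_trans jn; rewrite -ltn_subRL.
  have := chain (fun i => N (j0 - i)%N) (j0 - j)%N.
  rewrite /= subn0 subKn ?(ltnW jj)//; apply; rewrite ?(leq_trans (leq_subr _ _))//.
  move=> i ij; have ij0 : (i < j0)%N := leq_trans ij (leq_subr _ _).
  rewrite -(subnSK ij0); apply: (proj2 (step _ _)).
  by rewrite subnSK// (leq_trans (leq_subr _ _)).
exists h, x, y, p, q; split=> //; split.
- by split.
- move=> j jn; have [xC yC] := xyC j (leqW jn).
  have := bound j jn; rewrite /N => Nj; have p0 := normr_ge0 (p j); have q0 := normr_ge0 (q j).
  by rewrite !le_max xC yC; split=> //; apply/orP; right; lra.
- move=> j jn; rewrite {1}(mom1P x y j h0) {1}(mom2P x y j h0) /p /q.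
  by split; ring.
- exact: EL.
- by split; [exists j0|exists j1].
Qed.

End DiscreteSolutions.

(** * Passage to the continuous limit *)

Section StepFunctions.
Context {R : realType} (U : set_system nat).
Hypothesis UU : ProperFilter U.
Hypothesis ooU : \oo `<=` U.

(** The cap [n], and the value 0 of [truncn] at negative numbers, extend the step functions by
    constants outside [0,1]; the limit curves are thus defined and Lipschitz on the whole line. *)
Definition step_index (n : nat) (t : R) : nat := minn n (Num.truncn (t * n%:R)).

Lemma step_index_le n t : (step_index n t <= n)%N.
Proof. exact: geq_minl. Qed.

Lemma step_index_mono n s t : s <= t -> (step_index n s <= step_index n t)%N.
Proof.
move=> st; rewrite leq_min geq_minl/= (leq_trans (geq_minr _ _))//.
by apply: le_truncn; rewrite ler_wpM2r.
Qed.

Lemma step_index0 n : step_index n 0 = 0%N.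
Proof. by rewrite /step_index mul0r truncn0 minn0. Qed.

Lemma step_index1 n : step_index n 1 = n.
Proof. by rewrite /step_index mul1r natrK minnn. Qed.

Lemma step_index_close n t : 0 <= t <= 1 -> `|(step_index n t)%:R - t * n%:R| <= 1.
Proof.
move=> /andP[t0 t1]; have tn : 0 <= t * n%:R by rewrite mulr_ge0.
have -> : step_index n t = Num.truncn (t * n%:R).
  apply/minn_idPr; rewrite -[leqRHS](@natrK R); apply: le_truncn.
  by rewrite ler_piMl.
have /andP[a b] := truncn_itv tn.
rewrite -natr1 in b; rewrite ler_norml; apply/andP; split; lra.
Qed.

Lemma step_index_dist n s t : s <= t ->
  (step_index n t - step_index n s)%:R <= (t - s) * n%:R + 1 :> R.
Proof.
move=> st; apply: (@le_trans _ _ (Num.truncn (t * n%:R) - Num.truncn (s * n%:R))%:R).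
  rewrite ler_nat /step_index.
  have : (Num.truncn (s * n%:R) <= Num.truncn (t * n%:R))%N.
    by apply: le_truncn; rewrite ler_wpM2r.
  move: (Num.truncn _) (Num.truncn _) => i j; clear; lia.
have stn : s * n%:R <= t * n%:R by rewrite ler_wpM2r.
rewrite natrB; last exact: le_truncn.
have [t0|t0] := leP 0 (t * n%:R); last first.
  have -> : Num.truncn (t * n%:R) = 0%N.
    rewrite truncn_floor; have -> // : (0 <= t * n%:R) = false.
    by apply/negbTE; rewrite -ltNge.
  by have := ler0n R (Num.truncn (s * n%:R)); lra.
have /andP[a _] := truncn_itv t0.
have [s0|s0] := leP 0 (s * n%:R).
  have /andP[_ b] := truncn_itv s0; rewrite -natr1 in b; lra.
by have := ler0n R (Num.truncn (s * n%:R)); lra.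
Qed.

(* The filter of pairs (n, k) such that k / n tends to [s] as n runs along [U];
   a limit along it encodes a locally uniform limit of step functions at [s]. *)
Definition near_time (s : R) : set_system (nat * nat) :=
  [set A | exists2 d : R, 0 < d & \forall n \near U,
     forall k, (k <= n)%N -> `|k%:R - s * n%:R| <= d * n%:R -> A (n, k)].

Global Instance near_time_filter s : Filter (near_time s).
Proof.
split.
- by exists 1 => //; apply: nearW.
- move=> A B [d d0 dA] [e e0 eB]; exists (Num.min d e); first by rewrite lt_min d0.
  apply: filterS2 dA eB => n nA nB k kn kd; split.
    by apply: nA => //; apply: (le_trans kd); rewrite ler_wpM2r// ge_min lexx.
  by apply: nB => //; apply: (le_trans kd); rewrite ler_wpM2r// ge_min lexx orbT.
- move=> A B AB [d d0 dA]; exists d => //.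
  by apply: filterS dA => n nA k kn kd; apply/AB/nA.
Qed.

Lemma near_large (M : R) : \forall n \near U, M <= n%:R.
Proof. by apply: ooU; exact: nbhs_infty_ger. Qed.

(** The momentum equations involve values at the next index. The shift moves k / n by 1 / n only,
    and [s < 1] keeps [k.+1] within range. *)
Lemma near_time_succ s (V : topologicalType) (f : nat * nat -> V) (l : set_system V) : s < 1 ->
  f @ near_time s --> l -> f (u.1, u.2.+1) @[u --> near_time s] --> l.
Proof.
move=> s1 fl A /fl[d d0 dA].
pose e := Num.min (d / 2) ((1 - s) / 2).
have ed : e <= d / 2 by rewrite /e ge_min lexx.
have es : e <= (1 - s) / 2 by rewrite /e ge_min lexx orbT.
exists e; first by rewrite /e lt_min !divr_gt0// subr_gt0.
near=> n => k kn ke.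
have nd : 2 / d <= n%:R by near: n; exact: near_large.
have ns : 2 / (1 - s) <= n%:R by near: n; exact: near_large.
have nA : forall k, (k <= n)%N -> `|k%:R - s * n%:R| <= d * n%:R -> A (f (n, k)).
  by near: n.
rewrite ler_pdivrMr// in nd; rewrite ler_pdivrMr ?subr_gt0// in ns.
have ed' : e * n%:R <= d / 2 * n%:R by rewrite ler_wpM2r.
have es' : e * n%:R <= (1 - s) / 2 * n%:R by rewrite ler_wpM2r.
move: ke; rewrite ler_norml => /andP[k1 k2].
apply: nA; last by rewrite -natr1 ler_norml; apply/andP; split; lra.
by rewrite -(ler_nat R) -natr1; lra.
Unshelve. all: by end_near.
Qed.

Section Interpolation.
Variables (T C : R) (h : nat -> R) (z g : nat -> nat -> R) (zeta : R -> R).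
Hypothesis h0 : h @ U --> 0.
Hypothesis hT : n%:R * h n @[n --> U] --> T.
Hypothesis zrec : \forall n \near U, 0 <= h n /\ forall j, (j < n)%N ->
  z n j.+1 - z n j = h n * g n j /\ `|g n j| <= C.
Hypothesis zlim : forall t, z n (step_index n t) @[n --> U] --> zeta t.

Lemma increments_le n i j : 0 <= h n ->
  (forall j, (j < n)%N -> z n j.+1 - z n j = h n * g n j /\ `|g n j| <= C) ->
  (i <= j)%N -> (j <= n)%N -> `|z n j - z n i| <= (j - i)%:R * h n * C.
Proof.
move=> hn H ij jn.
have := @increments_close R (z n) (g n) (h n) C 0 i j hn ij.
rewrite mulr0 subr0; apply.
  by move=> k /andP[_ kj]; have [] := H k (leq_trans kj jn).
by move=> k /andP[_ kj]; rewrite subr0; have [] := H k (leq_trans kj jn).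
Qed.

(** A pointwise limit along [U] has no regularity of its own; it is inherited from the uniform bound
    on the slopes, in the role of the Arzela-Ascoli theorem. *)
Lemma limit_lipschitz (s t : R) : `|zeta t - zeta s| <= T * C * `|t - s|.
Proof.
wlog st : s t / s <= t.
  move=> H; have [st|/ltW ts] := leP s t; first exact: H.
  by rewrite distrC [`|t - s|]distrC; exact: H.
have cl : `|z n (step_index n t) - z n (step_index n s)| @[n --> U] --> `|zeta t - zeta s|.
  by apply: cvg_norm; apply: cvgB.
have cr : ((t - s) * (n%:R * h n) + h n) * C @[n --> U] --> ((t - s) * T + 0) * C.
  apply: cvgM; last exact: cvg_cst.
  by apply: cvgD => //; apply: cvgM => //; exact: cvg_cst.
rewrite (ger0_norm (_ : 0 <= t - s)) ?subr_ge0//.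
have -> : T * C * (t - s) = ((t - s) * T + 0) * C by ring.
rewrite -subr_ge0; apply: (cvgr_to_ge (cvgB cr cl)).
apply: filterS2 zrec (near_large 1) => n [hn H]; rewrite ler1n /= subr_ge0 => n0.
have := increments_le hn H (step_index_mono n st) (step_index_le n t).
move=> /le_trans; apply.
have C0 : 0 <= C by have [_] := H 0%N n0; exact: le_trans.
rewrite ler_wpM2r// mulrA -[X in _ + X]mul1r -mulrDl ler_wpM2r//.
exact: step_index_dist.
Qed.

(** Equicontinuity upgrades pointwise convergence to convergence at all indices near [s]. *)
Lemma near_time_cvg (s : R) : 0 <= s <= 1 -> z u.1 u.2 @[u --> near_time s] --> zeta s.
Proof.
move=> s01; apply/cvgrPdist_le => e e0.
(* Error budget: e / 2 for convergence at [s], e / 4 for the window of width e / D, and e / 4 for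
   the rounding of the index, which costs one step [h n]. *)
pose D : R := 4 * (`|T| + 1) * (`|C| + 1).
have D0 : 0 < D by rewrite !mulr_gt0// ltr_wpDl.
have C0 : 0 < `|C| + 1 by rewrite ltr_wpDl.
have T0 : 0 < `|T| + 1 by rewrite ltr_wpDl.
exists (e / D); first by rewrite divr_gt0.
near=> n => k kn ks.
have hn : 0 <= h n by near: n; apply: filterS zrec => n [].
have H : forall j, (j < n)%N -> z n j.+1 - z n j = h n * g n j /\ `|g n j| <= C.
  by near: n; apply: filterS zrec => n [].
have hsmall : h n <= e / (4 * (`|C| + 1)).
  by near: n; have /cvgr_le := h0; apply; rewrite divr_gt0// mulr_gt0.
have hTn : n%:R * h n <= `|T| + 1.
  by near: n; have /cvgr_le := hT; apply; rewrite ltr_pwDr// ler_norm.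
have zn : `|zeta s - z n (step_index n s)| <= e / 2.
  by near: n; have /cvgrPdist_le := @zlim s; apply; rewrite divr_gt0.
rewrite /=; set i := step_index n s in zn *.
have icl : `|i%:R - s * n%:R| <= 1 by exact: step_index_close.
have dist : `|z n i - z n k| <= `|i%:R - k%:R| * h n * C.
  have [ik|/ltnW ki] := leqP i k.
    have -> : `|i%:R - k%:R| = (k - i)%:R :> R.
      by rewrite distrC natrB// ger0_norm// subr_ge0 ler_nat.
    by rewrite distrC; exact: increments_le.
  have -> : `|i%:R - k%:R| = (i - k)%:R :> R.
    by rewrite natrB// ger0_norm// subr_ge0 ler_nat.
  by apply: increments_le => //; exact: step_index_le.
have ikd : `|i%:R - k%:R| <= e / D * n%:R + 1.
  have -> : i%:R - k%:R = (i%:R - s * n%:R) - (k%:R - s * n%:R) :> R by ring.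
  by apply: (le_trans (ler_normB _ _)); rewrite addrC lerD.
have : `|i%:R - k%:R| * h n * C <= e / 2.
  apply: (@le_trans _ _ ((e / D * n%:R + 1) * h n * (`|C| + 1))).
    apply: (@le_trans _ _ (`|i%:R - k%:R| * h n * (`|C| + 1))).
      by rewrite ler_wpM2l ?mulr_ge0//; have := ler_norm C; lra.
    by rewrite ler_wpM2r ?(ltW C0)// ler_wpM2r.
  have -> : (e / D * n%:R + 1) * h n * (`|C| + 1) =
      e / D * (`|C| + 1) * (n%:R * h n) + h n * (`|C| + 1) by ring.
  have a1 : e / D * (`|C| + 1) * (n%:R * h n) <= e / D * (`|C| + 1) * (`|T| + 1).
    by rewrite ler_wpM2l// mulr_ge0 ?(ltW C0)// divr_ge0// ltW.
  have e1 : e / D * (`|C| + 1) * (`|T| + 1) = e / 4.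
    by rewrite /D; field; rewrite !lt0r_neq0.
  have a2 : h n * (`|C| + 1) <= e / 4.
    rewrite -ler_pdivlMr//; apply: (le_trans hsmall).
    by rewrite invfM mulrA.
  by rewrite e1 in a1; lra.
have := ler_distD (z n i) (zeta s) (z n k); lra.
Unshelve. all: by end_near.
Qed.

(** In a short window around [s] all discrete slopes are close to [gam], hence so are the chords of
    the discrete curves and, in the limit, those of [zeta]. The factor [T] is the limit of
    [n%:R * h n]. *)
Lemma limit_derivative (s gam : R) : 0 < s < 1 ->
  g u.1 u.2 @[u --> near_time s] --> gam -> is_derive s 1 zeta (T * gam).
Proof.
move=> /andP[s0 s1] ggam; apply/is_derive_cvg/cvgrPdist_le => e e0.
have T0 : 0 < `|T| + 1 by rewrite ltr_wpDl.
(* [T] may vanish, whence the added 1. *)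
pose e' : R := e / (`|T| + 1); have e'0 : 0 < e' by rewrite divr_gt0.
move/cvgrPdist_le: ggam => /(_ e' e'0)[d d0 dg].
have key (i j : R) : 0 <= i -> i <= j -> j <= 1 -> `|i - s| <= d / 2 -> `|j - s| <= d / 2 ->
    `|zeta j - zeta i - (j - i) * T * gam| <= (j - i) * T * e'.
  move=> i0 ij j1 si sj.
  have i1 : 0 <= i <= 1 by rewrite i0 (le_trans ij).
  have j01 : 0 <= j <= 1 by rewrite j1 (le_trans i0).
  have icv : (step_index n j - step_index n i)%:R * h n @[n --> U] --> (j - i) * T.
    have E : (j - i) * (n%:R * h n) @[n --> U] --> (j - i) * T.
      by apply: cvgM => //; exact: cvg_cst.
    have E2 : (step_index n j - step_index n i)%:R * h n -
        (j - i) * (n%:R * h n) @[n --> U] --> (0 : R).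
      have h2 : 2 * `|h n| @[n --> U] --> (0 : R).
        have := cvgM (cvg_cst (2 : R)) (cvg_norm h0); rewrite normr0 mulr0; exact.
      apply/cvgrPdist_le => r r0.
      move/cvgrPdist_le: h2 => /(_ r r0); apply: filterS => n.
      rewrite !sub0r !normrN; apply: le_trans; rewrite [leRHS]ger0_norm//.
      rewrite natrB ?step_index_mono// mulrA -mulrBl normrM ler_wpM2r//.
      have -> : (step_index n j)%:R - (step_index n i)%:R - (j - i) * n%:R =
        ((step_index n j)%:R - j * n%:R) - ((step_index n i)%:R - i * n%:R) by ring.
      apply: (le_trans (ler_normB _ _)).
      by have := step_index_close n i1; have := step_index_close n j01; lra.
    exact: (cvg_sub0 E2 E).
  have cl : `|z n (step_index n j) - z n (step_index n i) -
      (step_index n j - step_index n i)%:R * h n * gam| @[n --> U] -->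
      `|zeta j - zeta i - (j - i) * T * gam|.
    apply: cvg_norm; apply: cvgB; first exact: cvgB.
    by apply: cvgM => //; exact: cvg_cst.
  have cr : (step_index n j - step_index n i)%:R * h n * e' @[n --> U] --> (j - i) * T * e'.
    by apply: cvgM => //; exact: cvg_cst.
  rewrite -subr_ge0; apply: (cvgr_to_ge (cvgB cr cl)).
  near=> n; rewrite /= subr_ge0.
  have hn : 0 <= h n by near: n; apply: filterS zrec => n [].
  have H : forall j, (j < n)%N -> z n j.+1 - z n j = h n * g n j /\ `|g n j| <= C.
    by near: n; apply: filterS zrec => n [].
  (* The half of the window left free by [i] and [j] absorbs the rounding error of [step_index],
     which is at most 1. *)
  have nd : 2 / d <= n%:R by near: n; exact: near_large.
  rewrite ler_pdivrMr// in nd.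
  have dgn : forall k, (k <= n)%N -> `|k%:R - s * n%:R| <= d * n%:R -> `|gam - g n k| <= e'.
    by near: n.
  apply: (@increments_close R (z n) (g n)) => //; first exact: step_index_mono.
    by move=> k /andP[_ kj]; have [] := H k (leq_trans kj (step_index_le _ _)).
  move=> k /andP[ik kj]; rewrite distrC; apply: dgn.
    by rewrite ltnW// (leq_trans kj)// step_index_le.
  have ki : (step_index n i)%:R <= k%:R :> R by rewrite ler_nat.
  have kj' : k%:R <= (step_index n j)%:R :> R by rewrite ler_nat ltnW.
  have := step_index_close n i1; have := step_index_close n j01.
  have n0 : 0 <= n%:R :> R by [].
  move: si sj; rewrite !ler_norml => /andP[u1 u2] /andP[u3 u4] /andP[u5 u6] /andP[u7 u8].
  have v1 : - (d / 2) * n%:R <= (i - s) * n%:R by rewrite ler_wpM2r.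
  have v2 : (j - s) * n%:R <= d / 2 * n%:R by rewrite ler_wpM2r.
  by apply/andP; split; lra.
have T_ge0 : 0 <= T.
  apply: (cvgr_to_ge hT); apply: filterS zrec => n [hn _].
  by rewrite mulr_ge0.
pose r := Num.min (d / 2) (Num.min s (1 - s)).
have rd : r <= d / 2 by rewrite /r ge_min lexx.
have rs : r <= s by rewrite /r !ge_min lexx !orbT.
have rs1 : r <= 1 - s by rewrite /r !ge_min lexx !orbT.
have r0 : 0 < r by rewrite /r !lt_min divr_gt0//= s0 subr_gt0.
exists r => //= t; rewrite /ball/= sub0r normrN => tr t_neq0.
have t0 : 0 < `|t| by rewrite normr_gt0.
suff : `|zeta (t + s) - zeta s - t * T * gam| <= `|t| * (T * e').
  have -> : T * gam - t^-1 * (zeta (t + s) - zeta s) =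
      - t^-1 * (zeta (t + s) - zeta s - t * T * gam) by field.
  move=> H; rewrite normrM normrN normfV ler_pdivrMl//; apply: (le_trans H).
  rewrite ler_pM2l// /e' (ger0_norm T_ge0) mulrCA ler_piMr ?(ltW e0)//.
  by rewrite ler_pdivrMr ?mul1r ?lerDl// ltr_wpDl.
move: tr; rewrite ltr_norml => /andP[tr1 tr2].
have [tp|tn] := leP 0 t.
  have K : `|zeta (t + s) - zeta s - (t + s - s) * T * gam| <= (t + s - s) * T * e'.
    by apply: key; rewrite ?ler_norml ?subrr ?addrK; lra.
  by rewrite addrK in K; rewrite (ger0_norm tp) mulrA.
have K : `|zeta s - zeta (t + s) - (s - (t + s)) * T * gam| <= (s - (t + s)) * T * e'.
  by apply: key; rewrite ?ler_norml ?subrr ?addrK; lra.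
rewrite (ltr0_norm tn) mulrA; move: K; rewrite -normrN.
have -> : s - (t + s) = - t by ring.
by have -> : - (zeta s - zeta (t + s) - - t * T * gam) =
  zeta (t + s) - zeta s - t * T * gam by ring.
Unshelve. all: by end_near.
Qed.

End Interpolation.
End StepFunctions.

Lemma lipschitz_continuous (R : realType) (f : R -> R) (L : R) :
  (forall s t : R, `|f t - f s| <= L * `|t - s|) -> continuous f.
Proof.
move=> fL s; apply/cvgrPdist_le => e e0.
have L0 : 0 < `|L| + 1 by rewrite ltr_wpDl.
exists (e / (`|L| + 1)) => /=; first by rewrite divr_gt0.
move=> t; rewrite /ball/= => st; rewrite ltr_pdivlMr// in st.
apply: (le_trans (fL t s)); apply: le_trans (ltW st).
by rewrite mulrC ler_wpM2l//; have := ler_norm L; lra.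
Qed.

(** Indices selected without any control, such as those where the energy is compared with [c], still
    converge to some time along an ultrafilter. *)
Lemma near_time_section (R : realType) (U : set_system nat) (UU : UltraFilter U)
    (j : nat -> nat) : \oo `<=` U ->
  (\forall n \near U, (j n <= n)%N) ->
  exists2 t : R, 0 <= t <= 1 & (n, j n) @[n --> U] --> near_time U t.
Proof.
move=> ooU jn.
have jn1 : \forall n \near U, 0 <= ((j n)%:R / n%:R : R) <= 1.
  apply: filterS jn => n jn; rewrite divr_ge0//=.
  by case: n jn => [|n] jn; [rewrite invr0 mulr0|rewrite ler_pdivrMr// mul1r ler_nat].
have [|t tl] := @ultrafilter_bounded_cvg R U UU (fun n => (j n)%:R / n%:R) 1.
  by apply: filterS jn1 => n /andP[? ?]; rewrite ger0_norm.
exists t.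
  apply/andP; split.
    by apply: (cvgr_to_ge tl); apply: filterS jn1 => n /andP[].
  by apply: (cvgr_to_le tl); apply: filterS jn1 => n /andP[].
move=> A [d d0 dA]; suff : \forall n \near U, A (n, j n) by [].
have /cvgrPdist_le/(_ d d0) tld := tl.
near=> n.
have n0 : 1 <= n%:R :> R by near: n; exact: near_large.
have n00 : 0 < n%:R :> R by lra.
have nA : forall k, (k <= n)%N -> `|k%:R - t * n%:R| <= d * n%:R -> A (n, k) by near: n.
apply: nA; first by near: n.
have td : `|t - (j n)%:R / n%:R| <= d by near: n.
have -> : (j n)%:R - t * n%:R = - ((t - (j n)%:R / n%:R) * n%:R).
  by field; rewrite lt0r_neq0.
by rewrite normrN normrM (gtr0_norm n00) ler_wpM2r// ltW.
Unshelve. all: by end_near.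
Qed.

(** * The limit orbit and its energy *)

Section ConnectingOrbit.
Context {R : realType} (W W1 W2 : R -> R -> R) (c a1 a2 b1 b2 : R).

Hypothesis cW : joint_continuous W.
Hypothesis cW1 : joint_continuous W1.
Hypothesis cW2 : joint_continuous W2.
Hypothesis dW1 : forall u v : R, is_derive u 1 (W ^~ v) (W1 u v).
Hypothesis dW2 : forall u v : R, is_derive v 1 (W u) (W2 u v).
Hypothesis W_ge0 : forall u v, 0 <= W u v.
Hypothesis c_gt0 : 0 < c.

Lemma energy_cvg (T : Type) (F : set_system T) (FF : Filter F)
    (x y p q : T -> R) (x' y' p' q' : R) :
  x @ F --> x' -> y @ F --> y' -> p @ F --> p' -> q @ F --> q' ->
  energy W (x t) (y t) (p t) (q t) @[t --> F] --> energy W x' y' p' q'.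
Proof.
move=> xx yy pp qq; apply: cvgB; last exact: joint_cvg.
apply: cvgB; last exact: cvgM.
apply: cvgD; last exact: cvgM.
apply: cvgM; last exact: cvg_cst.
by rewrite !expr2; under eq_fun do rewrite !expr2; apply: cvgD; exact: cvgM.
Qed.

(** Time is rescaled to [0,1]; the factor [T], the original duration, becomes eta. *)
Definition hamilton_flow (T : R) (x y p q : R -> R) : Prop :=
  forall t : R, 0 < t < 1 ->
    [/\ is_derive t 1 x (T * (p t + y t)),
        is_derive t 1 y (T * (q t - x t)),
        is_derive t 1 p (T * (q t + W1 (x t) (y t))) &
        is_derive t 1 q (T * (- p t + W2 (x t) (y t)))].

Lemma energy_derivative T x y p q (t : R) : hamilton_flow T x y p q -> 0 < t < 1 ->
  is_derive t 1 (fun t => energy W (x t) (y t) (p t) (q t)) 0.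
Proof.
move=> H /H[dx dy dp dq].
have dW := chain_rule2 cW1 cW2 dW1 dW2 dx dy.
apply: is_derive_eq (derB (derB (derD (derM (derD (derX2 dp) (derX2 dq))
  (derC 2^-1 t)) (derM dp dy)) (derM dq dx)) dW) _.
by field.
Qed.

Lemma connecting_orbit : 0 < `|b1 - a1| + `|b2 - a2| ->
  exists (T : R) (x y p q : R -> R),
    [/\ 0 <= T /\ hamilton_flow T x y p q,
        [/\ x 0 = a1, y 0 = a2, x 1 = b1 & y 1 = b2],
        [/\ continuous x, continuous y, continuous p & continuous q] &
        forall t, 0 <= t <= 1 -> energy W (x t) (y t) (p t) (q t) = c].
Proof.
move=> d0.
have [C [Tm [C0 Tm0 HS]]] := discrete_solutions cW cW1 cW2 dW1 dW2 W_ge0 c_gt0 d0.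
have [B1 [B10 W1B]] := joint_bounded C cW1.
have [B2 [B20 W2B]] := joint_bounded C cW2.
have /choice[h /choice[x /choice[y /choice[p /choice[q HD]]]]] n :
    exists h x y p q, 2 * Tm <= n.+1%:R -> n.+1%:R * h <= Tm /\
      symplectic_euler W W1 W2 c a1 a2 b1 b2 n h C x y p q.
  have [/HS[h [x [y [p [q H]]]]]|] := boolP (2 * Tm <= n.+1%:R).
    by exists h, x, y, p, q.
  by exists 0, (fun=> 0), (fun=> 0), (fun=> 0), (fun=> 0).
have [U [UU ooU]] := ultrafilter_on_nat.
have PU : ProperFilter U by exact: ultra_proper.
have good : \forall n \near U, n.+1%:R * h n <= Tm /\
    symplectic_euler W W1 W2 c a1 a2 b1 b2 n (h n) C (x n) (y n) (p n) (q n).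
  apply: filterS (near_large ooU (2 * Tm)) => n Tn.
  by apply: HD; apply: (le_trans Tn); rewrite ler_nat.
have h_ge0 : \forall n \near U, 0 <= h n.
  by apply: filterS good => n [_ [[/ltW]]].
have hT : \forall n \near U, n%:R * h n <= Tm.
  apply: filterS2 good h_ge0 => n [+ _] hn; apply: le_trans.
  by rewrite ler_wpM2r// ler_nat.
have h0 : h @ U --> (0 : R).
  apply/cvgrPdist_le => e e0; near=> n.
  have hn : 0 <= h n by near: n.
  have hTn : n%:R * h n <= Tm by near: n.
  have n1 : 1 <= n%:R :> R by near: n; exact: near_large.
  have nT : Tm / e <= n%:R by near: n; exact: near_large.
  rewrite sub0r normrN ger0_norm// -(ler_pM2l (_ : 0 < n%:R)); last by lra.
  by apply: (le_trans hTn); rewrite ler_pdivrMr in nT.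
have [T TP] : exists T : R, n%:R * h n @[n --> U] --> T.
  apply: (@ultrafilter_bounded_cvg R U UU (fun n => n%:R * h n) Tm).
  by apply: filterS2 hT h_ge0 => n hT hn; rewrite ger0_norm// mulr_ge0.
have bnd (z : nat -> nat -> R) : (\forall n \near U, forall j, (j <= n)%N -> `|z n j| <= C) ->
    exists zeta : R -> R, forall t, z n (step_index n t) @[n --> U] --> zeta t.
  move=> zC.
  have /choice[zeta zl] (t : R) : exists l : R, z n (step_index n t) @[n --> U] --> l.
    apply: (@ultrafilter_bounded_cvg R U UU (fun n => z n (step_index n t)) C).
    by apply: filterS zC => n; apply; exact: step_index_le.
  by exists zeta.
have xC : \forall n \near U, forall j, (j <= n)%N -> `|x n j| <= C.
  by apply: filterS good => n [_ [_ H _ _ _]] j /H[].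
have yC : \forall n \near U, forall j, (j <= n)%N -> `|y n j| <= C.
  by apply: filterS good => n [_ [_ H _ _ _]] j /H[].
have pC : \forall n \near U, forall j, (j <= n)%N -> `|p n j| <= C.
  by apply: filterS good => n [_ [_ H _ _ _]] j /H[].
have qC : \forall n \near U, forall j, (j <= n)%N -> `|q n j| <= C.
  by apply: filterS good => n [_ [_ H _ _ _]] j /H[].
have [X Xl] := bnd x xC; have [Y Yl] := bnd y yC.
have [P Pl] := bnd p pC; have [Q Ql] := bnd q qC.
pose gx n j : R := p n j + y n j; pose gy n j : R := q n j - x n j.
pose gp n j : R := q n j.+1 + W1 (x n j.+1) (y n j.+1).
pose gq n j : R := - p n j.+1 + W2 (x n j.+1) (y n j.+1).
have xrec : \forall n \near U, 0 <= h n /\ forall j, (j < n)%N ->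
    x n j.+1 - x n j = h n * gx n j /\ `|gx n j| <= C + C.
  apply: filterS2 h_ge0 good => n hn [_ [_ B D _ _]]; split=> // j jn.
  have [_ yb pb _] := B j (ltnW jn); have [-> _] := D j (ltnW jn); split=> //.
  by apply: (le_trans (ler_normD _ _)); rewrite lerD.
have yrec : \forall n \near U, 0 <= h n /\ forall j, (j < n)%N ->
    y n j.+1 - y n j = h n * gy n j /\ `|gy n j| <= C + C.
  apply: filterS2 h_ge0 good => n hn [_ [_ B D _ _]]; split=> // j jn.
  have [xb _ _ qb] := B j (ltnW jn); have [_ ->] := D j (ltnW jn); split=> //.
  by apply: (le_trans (ler_normB _ _)); rewrite lerD.
have prec : \forall n \near U, 0 <= h n /\ forall j, (j < n)%N ->
    p n j.+1 - p n j = h n * gp n j /\ `|gp n j| <= C + B1.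
  apply: filterS2 h_ge0 good => n hn [_ [_ B _ D _]]; split=> // j jn.
  have [xb yb _ qb] := B j.+1 jn; have [-> _] := D j jn; split=> //.
  by apply: (le_trans (ler_normD _ _)); rewrite lerD// W1B.
have qrec : \forall n \near U, 0 <= h n /\ forall j, (j < n)%N ->
    q n j.+1 - q n j = h n * gq n j /\ `|gq n j| <= C + B2.
  apply: filterS2 h_ge0 good => n hn [_ [_ B _ D _]]; split=> // j jn.
  have [xb yb pb _] := B j.+1 jn; have [_ ->] := D j jn; split=> //.
  by apply: (le_trans (ler_normD _ _)); rewrite normrN lerD// W2B.
have Xs s : 0 <= s <= 1 -> x u.1 u.2 @[u --> near_time U s] --> X s.
  exact: (near_time_cvg PU h0 TP xrec Xl).
have Ys s : 0 <= s <= 1 -> y u.1 u.2 @[u --> near_time U s] --> Y s.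
  exact: (near_time_cvg PU h0 TP yrec Yl).
have Ps s : 0 <= s <= 1 -> p u.1 u.2 @[u --> near_time U s] --> P s.
  exact: (near_time_cvg PU h0 TP prec Pl).
have Qs s : 0 <= s <= 1 -> q u.1 u.2 @[u --> near_time U s] --> Q s.
  exact: (near_time_cvg PU h0 TP qrec Ql).
have flow : hamilton_flow T X Y P Q.
  move=> s s01; have /andP[s0 s1] := s01.
  have s01' : 0 <= s <= 1 by rewrite !ltW.
  have shift (z : nat -> nat -> R) (l : R) : z u.1 u.2 @[u --> near_time U s] --> l ->
      z u.1 u.2.+1 @[u --> near_time U s] --> l.
    exact: (near_time_succ PU ooU (f := fun u => z u.1 u.2) s1).
  have Xs' : x u.1 u.2.+1 @[u --> near_time U s] --> X s by apply: shift; exact: Xs.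
  have Ys' : y u.1 u.2.+1 @[u --> near_time U s] --> Y s by apply: shift; exact: Ys.
  split.
  - apply: (limit_derivative PU ooU h0 TP xrec Xl s01).
    by apply: cvgD; [exact: Ps|exact: Ys].
  - apply: (limit_derivative PU ooU h0 TP yrec Yl s01).
    by apply: cvgB; [exact: Qs|exact: Xs].
  - apply: (limit_derivative PU ooU h0 TP prec Pl s01).
    by apply: cvgD; [apply: shift; exact: Qs|exact: joint_cvg].
  - apply: (limit_derivative PU ooU h0 TP qrec Ql s01).
    by apply: cvgD; [apply: cvgN; apply: shift; exact: Ps|exact: joint_cvg].
have X_cont : continuous X := lipschitz_continuous (limit_lipschitz PU ooU h0 TP xrec Xl).
have Y_cont : continuous Y := lipschitz_continuous (limit_lipschitz PU ooU h0 TP yrec Yl).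
have P_cont : continuous P := lipschitz_continuous (limit_lipschitz PU ooU h0 TP prec Pl).
have Q_cont : continuous Q := lipschitz_continuous (limit_lipschitz PU ooU h0 TP qrec Ql).
have limit_start (z : nat -> nat -> R) (zeta : R -> R) a :
    (forall t, z n (step_index n t) @[n --> U] --> zeta t) ->
    (\forall n \near U, z n 0%N = a) -> zeta 0 = a.
  move=> zl za; apply/eqP; rewrite eq_le; apply/andP; split.
    by apply: (cvgr_to_le (zl 0)); apply: filterS za => n <-; rewrite step_index0.
  by apply: (cvgr_to_ge (zl 0)); apply: filterS za => n <-; rewrite step_index0.
(* The discrete path ends at index [n.+1], whereas [step_index n 1] is [n]; the missing last step
   has length at most [h n * (C + C)] and disappears in the limit. *)
have limit_end (z : nat -> nat -> R) (zeta : R -> R) b :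
    (forall t, z n (step_index n t) @[n --> U] --> zeta t) ->
    (\forall n \near U, `|z n n - b| <= h n * (C + C)) -> zeta 1 = b.
  move=> zl zb; apply/eqP; rewrite -subr_eq0 -normr_le0.
  have l1 : `|z n n - b| @[n --> U] --> `|zeta 1 - b|.
    apply: cvg_norm; apply: cvgB; last exact: cvg_cst.
    by have := zl 1; under eq_fun do rewrite step_index1.
  have l2 : h n * (C + C) @[n --> U] --> 0 * (C + C).
    by apply: cvgM => //; exact: cvg_cst.
  rewrite mul0r in l2.
  rewrite -subr_ge0; apply: (cvgr_to_ge (cvgB l2 l1)).
  by apply: filterS zb => n; rewrite /= subr_ge0.
have T_ge0 : 0 <= T.
  by apply: (cvgr_to_ge TP); apply: filterS h_ge0 => n hn; rewrite mulr_ge0.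
exists T, X, Y, P, Q; split=> //.
  split.
  - apply: (limit_start _ _ _ Xl); apply: filterS good => n [_ [[]]] //.
  - apply: (limit_start _ _ _ Yl); apply: filterS good => n [_ [[]]] //.
  - apply: (limit_end _ _ _ Xl).
    apply: filterS good => n [_ [[hn _ _ <- _] B D _ _]].
    have [_ yb pb _] := B n (leqnn n); have [e _] := D n (leqnn n).
    rewrite distrC e normrM gtr0_norm// ler_pM2l//.
    by apply: (le_trans (ler_normD _ _)); rewrite lerD.
  - apply: (limit_end _ _ _ Yl).
    apply: filterS good => n [_ [[hn _ _ _ <-] B D _ _]].
    have [xb _ _ qb] := B n (leqnn n); have [_ e] := D n (leqnn n).
    rewrite distrC e normrM gtr0_norm// ler_pM2l//.
    by apply: (le_trans (ler_normB _ _)); rewrite lerD.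
pose E t := energy W (X t) (Y t) (P t) (Q t).
have E_cont : continuous E.
  move=> t; apply: energy_cvg;
  [exact: X_cont|exact: Y_cont|exact: P_cont|exact: Q_cont].
have E_const s t : 0 <= s -> s <= t -> t <= 1 -> E t = E s.
  move=> s0 st t1; apply/eqP; rewrite -subr_eq0.
  have [r||r _ ->] := @MVT_segment R E (fun=> 0) s t st.
  - rewrite in_itv/= => /andP[sr rt]; apply: (energy_derivative flow).
    by rewrite (le_lt_trans s0 sr) (lt_le_trans rt t1).
  - exact: continuous_subspaceT.
  by rewrite mul0r.
have E_near (j : nat -> nat) : (\forall n \near U, (j n <= n)%N) ->
    exists2 t : R, 0 <= t <= 1 &
      energy W (x n (j n)) (y n (j n)) (p n (j n)) (q n (j n)) @[n --> U] --> E t.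
  move=> jn; have [t t01 tj] := near_time_section R UU ooU jn.
  exists t => //; apply: energy_cvg.
  - exact: (cvg_comp _ _ tj (Xs t t01)).
  - exact: (cvg_comp _ _ tj (Ys t t01)).
  - exact: (cvg_comp _ _ tj (Ps t t01)).
  - exact: (cvg_comp _ _ tj (Qs t t01)).
have E0 t : 0 <= t <= 1 -> E t = E 0.
  by move=> /andP[t0 t1]; exact: E_const.
(* The energy of the limit is constant, so evaluating it at the limit times of [jl] and [jg] gives
   both inequalities with [c]. *)
have /choice[jl jlP] n : exists j, symplectic_euler W W1 W2 c a1 a2 b1 b2 n (h n) C
    (x n) (y n) (p n) (q n) -> (j <= n)%N /\ energy W (x n j) (y n j) (p n j) (q n j) <= c.
  have [[_ _ _ _ [[j jn Ej] _]]|] := pselect (symplectic_euler W W1 W2 c a1 a2 b1 b2 n (h n) C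
    (x n) (y n) (p n) (q n)); first by exists j.
  by exists 0%N.
have /choice[jg jgP] n : exists j, symplectic_euler W W1 W2 c a1 a2 b1 b2 n (h n) C
    (x n) (y n) (p n) (q n) -> (j <= n)%N /\ c <= energy W (x n j) (y n j) (p n j) (q n j).
  have [[_ _ _ _ [_ [j jn Ej]]]|] := pselect (symplectic_euler W W1 W2 c a1 a2 b1 b2 n (h n) C
    (x n) (y n) (p n) (q n)); first by exists j.
  by exists 0%N.
have [|t t01 Et] := E_near jl; first by apply: filterS good => n [_ /jlP[]].
have [|s s01 Es] := E_near jg; first by apply: filterS good => n [_ /jgP[]].
have E0c : E 0 = c.
  apply/eqP; rewrite eq_le -{1}(E0 _ t01) -(E0 _ s01); apply/andP; split.
    by apply: (cvgr_to_le Et); apply: filterS good => n [_ /jlP[]].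
  by apply: (cvgr_to_ge Es); apply: filterS good => n [_ /jgP[]].
by move=> r /E0; rewrite E0c.
Unshelve. all: by end_near.
Qed.

End ConnectingOrbit.

(** * Convexity of the disk *)

Section MaximumPrinciple.
Context {R : realType}.

Definition pospart (u : R) : R := (u + `|u|) / 2.

Lemma pospart_ge (u : R) : 0 <= u -> pospart u = u.
Proof. by move=> u0; rewrite /pospart ger0_norm//; lra. Qed.

Lemma pospart_le (u : R) : u <= 0 -> pospart u = 0.
Proof. by move=> u0; rewrite /pospart ler0_norm//; lra. Qed.

(** Whatever the signs of [t] and [h + t], the first-order remainder is at most h^2; squaring
    removes the kink at 0, and the penalty is C^1. *)
Lemma der_pospart2 (t : R) : is_derive t 1 (fun u => pospart u ^+ 2) (2 * pospart t).
Proof.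
apply/is_derive_cvg/cvgrPdist_le => e e0; exists e => //= h.
rewrite /ball/= sub0r normrN => he hn0.
have h0 : 0 < `|h| by rewrite normr_gt0.
apply: le_trans (ltW he).
have -> : 2 * pospart t - h^-1 * (pospart (h + t) ^+ 2 - pospart t ^+ 2) =
  - h^-1 * (pospart (h + t) ^+ 2 - pospart t ^+ 2 - h * (2 * pospart t)) by field.
rewrite normrM normrN normfV ler_pdivrMl// -expr2 real_normK ?num_real//.
have [t0|t0] := leP 0 t; have [u0|u0] := leP 0 (h + t).
- rewrite (pospart_ge t0) (pospart_ge u0).
  have -> : (h + t) ^+ 2 - t ^+ 2 - h * (2 * t) = h ^+ 2 by ring.
  by rewrite ger0_norm ?sqr_ge0.
- by rewrite (pospart_ge t0) (pospart_le (ltW u0)) ler_norml; apply/andP; split; nra.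
- by rewrite (pospart_le (ltW t0)) (pospart_ge u0) ler_norml; apply/andP; split; nra.
- rewrite (pospart_le (ltW t0)) (pospart_le (ltW u0)) expr0n/=.
  by rewrite mulr0 subrr mulr0 subrr normr0; exact: sqr_ge0.
Qed.

(** If [k] were positive, [D] would be positive immediately to the right of its zero [t0], and [f]
    would increase there. Differentiability of [D] is required at [t0] alone, which is what a C^1
    penalty provides. *)
Lemma second_derivative_at_max (f D : R -> R) (a b t0 k : R) :
  (forall t, a < t < b -> is_derive t 1 f (D t)) ->
  is_derive t0 1 D k -> a < t0 < b ->
  (forall t, a < t < b -> f t <= f t0) -> k <= 0.
Proof.
move=> fD Dk /andP[at0 t0b] fmax; rewrite leNgt; apply/negP => k0.
have D0 : D t0 = 0.
  have t0ab : a < t0 < b by rewrite at0.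
  have [_ <-] := fD t0 t0ab.
  have [_ ->//] : is_derive t0 1 f 0.
  apply: (@derive1_at_max R f a b t0).
  - by lra.
  - by move=> t; rewrite in_itv => /fD[].
  - by rewrite in_itv.
  - by move=> t; rewrite in_itv; exact: fmax.
have /is_derive_cvg/cvgr_gt/(_ 0 k0)[e /= e0 De] := Dk.
pose d := Num.min (e / 2) ((b - t0) / 2).
have de : d <= e / 2 by rewrite /d ge_min lexx.
have db : d <= (b - t0) / 2 by rewrite /d ge_min lexx orbT.
have d0 : 0 < d by rewrite /d lt_min !divr_gt0// subr_gt0.
have [|||xi] := @MVT R f D t0 (t0 + d).
- by rewrite ltrDl.
- by move=> x; rewrite in_itv/= => /andP[x1 x2]; apply: fD; apply/andP; split; lra.
- apply: derivable_within_continuous => x; rewrite in_itv/= => /andP[x1 x2].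
  by have [] : is_derive x 1 f (D x) by apply: fD; apply/andP; split; lra.
rewrite in_itv/= => /andP[x1 x2] E.
have : 0 < (xi - t0)^-1 * (D (xi - t0 + t0) - D t0).
  apply: De; last by rewrite subr_eq0 gt_eqF.
  by rewrite /ball/= sub0r normrN gtr0_norm ?subr_gt0//; lra.
rewrite subrK D0 subr0 pmulr_rgt0 ?invr_gt0 ?subr_gt0// => Dxi.
have : f (t0 + d) <= f t0 by apply: fmax; apply/andP; split; lra.
rewrite -subr_le0 E addrAC subrr add0r leNgt mulr_gt0//.
Qed.

Variables (V V1 V2 : R -> R -> R) (R1 a c : R).
Hypothesis R1_gt0 : 0 < R1.
Hypothesis a_gt0 : 0 < a.
Hypothesis c_gt0 : 0 < c.
Hypothesis c_large : 2 * a * R1 < c ^+ 2.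
Hypothesis V_decay : forall x y, R1 ^+ 2 < x ^+ 2 + y ^+ 2 ->
  V x y <= a / Num.sqrt (x ^+ 2 + y ^+ 2).
Hypothesis V_radial : forall x y, R1 ^+ 2 < x ^+ 2 + y ^+ 2 ->
  0 <= x * V1 x y + y * V2 x y + 2 * V x y.

Definition excess (x y : R) : R := pospart (x ^+ 2 + y ^+ 2 - R1 ^+ 2).
(* Chosen so that 4 M R1^5 >= 2 a, which closes the estimate below. *)
Definition penalty_weight : R := a / R1 ^+ 5.
Local Notation M := penalty_weight.

Definition penalized (x y : R) : R := V x y + M * excess x y ^+ 2.
Definition penalized1 (x y : R) : R := V1 x y + 4 * M * excess x y * x.
Definition penalized2 (x y : R) : R := V2 x y + 4 * M * excess x y * y.

Lemma excess_disk x y : x ^+ 2 + y ^+ 2 <= R1 ^+ 2 -> excess x y = 0.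
Proof. by move=> xy; rewrite /excess pospart_le// subr_le0. Qed.

(* If the claim failed, the angular momentum [l := p y - q x] would be at
   least [c + Psi + 2 M k s] (with [s = x^2 + y^2], [k = s - R1^2] and
   [Psi = M k^2]); by Cauchy-Schwarz [l^2 <= (p^2 + q^2) s], the energy equation
   then gives [V >= c^2 / (2 s) + 2 M k s], which the choice of [M] excludes. *)
Lemma radial_convexity x y p q :
  R1 ^+ 2 < x ^+ 2 + y ^+ 2 -> energy penalized x y p q = c ->
  0 < p ^+ 2 + q ^+ 2 + x * penalized1 x y + y * penalized2 x y.
Proof.
move=> sR; rewrite /energy /penalized /penalized1 /penalized2.
have k0 : 0 < x ^+ 2 + y ^+ 2 - R1 ^+ 2 by rewrite subr_gt0.
have -> : excess x y = x ^+ 2 + y ^+ 2 - R1 ^+ 2 by rewrite /excess pospart_ge// ltW.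
have := V_decay sR; have := V_radial sR.
move: (V x y) (V1 x y) (V2 x y) => v v1 v2 rad dec en.
have M0 : 0 < M by rewrite divr_gt0// exprn_gt0.
have [l lE] : exists l, l = p * y - q * x by eexists.
have [s sE] : exists s, s = x ^+ 2 + y ^+ 2 by eexists.
have CS : l ^+ 2 <= (p ^+ 2 + q ^+ 2) * s.
  by rewrite lE sE -subr_ge0; have := sqr_ge0 (p * x + q * y); lra.
rewrite -sE in sR k0 dec en *.
have s0 : 0 < s by apply: lt_trans sR; rewrite exprn_gt0.
rewrite ltNge; apply/negP => neg.
have lge : c + M * (s - R1 ^+ 2) ^+ 2 + 2 * M * (s - R1 ^+ 2) * s <= l.
  have e k : 4 * M * k * s = x * (4 * M * k * x) + y * (4 * M * k * y).
    by rewrite sE; ring.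
  by have := e (s - R1 ^+ 2); move: neg en rad; rewrite lE; lra.
have Mk0 : 0 <= M * (s - R1 ^+ 2) ^+ 2 by rewrite mulr_ge0 ?sqr_ge0// ltW.
have Mks : 0 <= M * (s - R1 ^+ 2) * s by apply: ltW; apply: mulr_gt0 => //; apply: mulr_gt0.
have cl' : c <= l by lra.
have cl : c ^+ 2 <= l ^+ 2.
  by rewrite lerXn2r// nnegrE ?(le_trans (ltW c_gt0))// ltW.
have vge : c ^+ 2 + 4 * M * (s - R1 ^+ 2) * s * s <= 2 * s * v.
  have e : (p ^+ 2 + q ^+ 2) * s = 2 * s * (c + v + M * (s - R1 ^+ 2) ^+ 2 - l).
    by rewrite -[c]en lE; field.
  have : s * (c + M * (s - R1 ^+ 2) ^+ 2 + 2 * M * (s - R1 ^+ 2) * s) <= s * l.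
    by rewrite ler_pM2l.
  by rewrite e in CS; lra.
have [r rE] : exists r, r = Num.sqrt s by eexists.
have rs : s = r ^+ 2 by rewrite rE sqr_sqrtr// ltW.
rewrite -rE in dec.
have r0 : 0 < r by rewrite rE sqrtr_gt0.
have rR : R1 < r by rewrite -(@ltr_pXn2r _ 2)// ?nnegrE -?rs// ltW.
have v2r : 2 * s * v <= 2 * a * r.
  have -> : 2 * a * r = 2 * s * (a / r) by rewrite rs; field; rewrite lt0r_neq0.
  by rewrite ler_pM2l// mulr_gt0.
(* Both sides contain the factor r - R1, because s - R1^2 = (r - R1) (r + R1). Combined with [vge]
   and [v2r] this leaves c^2 <= 2 a R1. *)
have big : 2 * a * (r - R1) <= 4 * M * (s - R1 ^+ 2) * s * s.
  have -> : 4 * M * (s - R1 ^+ 2) * s * s = (r - R1) * (4 * M * ((r + R1) * r ^+ 4)).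
    by rewrite rs; ring.
  rewrite [leLHS]mulrC ler_pM2l ?subr_gt0//.
  have -> : 2 * a = 2 * M * R1 ^+ 5 by rewrite /M; field; rewrite lt0r_neq0.
  have -> : 4 * M * ((r + R1) * r ^+ 4) = 2 * M * (2 * ((r + R1) * r ^+ 4)) by ring.
  rewrite ler_pM2l; last by apply: mulr_gt0.
  have r4 : R1 ^+ 4 <= r ^+ 4 by rewrite lerXn2r// ?nnegrE ltW.
  have -> : R1 ^+ 5 = R1 * R1 ^+ 4 by ring.
  have R4 : 0 < R1 ^+ 4 by rewrite exprn_gt0.
  have : R1 * R1 ^+ 4 <= (r + R1) * r ^+ 4.
    by apply: ler_pM => //; [exact: ltW|exact: ltW|lra].
  have : 0 <= (r + R1) * r ^+ 4.
    by apply: mulr_ge0; [rewrite addr_ge0// ltW|rewrite exprn_ge0// ltW].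
  lra.
have := c_large; lra.
Qed.

Lemma orbit_in_disk (T : R) (x y p q : R -> R) : 0 < T ->
  hamilton_flow penalized1 penalized2 T x y p q ->
  continuous x -> continuous y ->
  (forall t, 0 <= t <= 1 -> energy penalized (x t) (y t) (p t) (q t) = c) ->
  x 0 ^+ 2 + y 0 ^+ 2 <= R1 ^+ 2 -> x 1 ^+ 2 + y 1 ^+ 2 <= R1 ^+ 2 ->
  forall t, 0 <= t <= 1 -> x t ^+ 2 + y t ^+ 2 <= R1 ^+ 2.
Proof.
move=> T0 flow cx cy en in0 in1.
pose f (t : R) : R := x t ^+ 2 + y t ^+ 2.
have cf : continuous f.
  move=> t; apply: cvgD; rewrite expr2; under eq_fun do rewrite expr2;
  by apply: cvgM; [exact: cx || exact: cy|exact: cx || exact: cy].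
have [t0 t01 fmax] := @EVT_max R f 0 1 ler01 (continuous_subspaceT cf).
rewrite in_itv/= in t01.
suff ft0 : f t0 <= R1 ^+ 2.
  by move=> t t1; apply: le_trans ft0; apply: fmax; rewrite in_itv.
rewrite leNgt; apply/negP => big.
have {}t01 : 0 < t0 < 1.
  move/andP: t01 => [t00 t1]; rewrite !lt_neqAle t00 t1 !andbT.
  apply/andP; split; apply/negP => /eqP e; move: big; rewrite ltNge => /negP; apply.
    by rewrite -e.
  by rewrite e.
(* The rotation terms cancel in the derivative of |q|^2, and again in that of [x p + y q]; the
   second derivative is therefore 2 T^2 times the quantity in [radial_convexity]. *)
pose D (t : R) : R := 2 * T * (x t * p t + y t * q t).
have fD (t : R) : 0 < t < 1 -> is_derive t 1 f (D t).
  move=> /flow[dx dy _ _]; apply: is_derive_eq (derD (derX2 dx) (derX2 dy)) _.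
  by rewrite /D; ring.
have [dx dy dp dq] := flow t0 t01.
have dD := derM (derC (2 * T) t0) (derD (derM dx dp) (derM dy dq)).
have t01' : 0 <= t0 <= 1 by move/andP: t01 => [? ?]; rewrite !ltW.
have G0 := radial_convexity big (en t0 t01').
have := second_derivative_at_max fD dD t01.
set k := (X in X <= 0).
have -> : k = 2 * T ^+ 2 * (p t0 ^+ 2 + q t0 ^+ 2 +
    x t0 * penalized1 (x t0) (y t0) + y t0 * penalized2 (x t0) (y t0)).
  by rewrite /k; ring.
move=> H; have : 2 * T ^+ 2 * (p t0 ^+ 2 + q t0 ^+ 2 +
    x t0 * penalized1 (x t0) (y t0) + y t0 * penalized2 (x t0) (y t0)) <= 0.
  by apply: H => t /andP[ta tb]; apply: fmax; rewrite in_itv/= !ltW.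
by rewrite leNgt !mulr_gt0// exprn_gt0.
Qed.

End MaximumPrinciple.

(** * The penalised orbit stays in the disk and solves the original equations *)

Section ChordInDisk.
Context {R : realType}.
Variables (V V1 V2 : R -> R -> R) (R1 a c : R).
Hypothesis cV : joint_continuous V.
Hypothesis cV1 : joint_continuous V1.
Hypothesis cV2 : joint_continuous V2.
Hypothesis dV1 : forall u v : R, is_derive u 1 (V ^~ v) (V1 u v).
Hypothesis dV2 : forall u v : R, is_derive v 1 (V u) (V2 u v).
Hypothesis V_ge0 : forall u v, 0 <= V u v.
Hypothesis R1_gt0 : 0 < R1.
Hypothesis a_gt0 : 0 < a.
Hypothesis c_gt0 : 0 < c.
Hypothesis c_large : 2 * a * R1 < c ^+ 2.
Hypothesis V_decay : forall x y, R1 ^+ 2 < x ^+ 2 + y ^+ 2 ->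
  V x y <= a / Num.sqrt (x ^+ 2 + y ^+ 2).
Hypothesis V_radial : forall x y, R1 ^+ 2 < x ^+ 2 + y ^+ 2 ->
  0 <= x * V1 x y + y * V2 x y + 2 * V x y.

Lemma excess_cvg (T : Type) (F : set_system T) (FF : Filter F) (x y : T -> R) (x' y' : R) :
  x @ F --> x' -> y @ F --> y' -> excess R1 (x t) (y t) @[t --> F] --> excess R1 x' y'.
Proof.
move=> xx yy.
have k : x t ^+ 2 + y t ^+ 2 - R1 ^+ 2 @[t --> F] --> x' ^+ 2 + y' ^+ 2 - R1 ^+ 2.
  apply: cvgB; last exact: cvg_cst.
  by rewrite !expr2; under eq_fun do rewrite !expr2; apply: cvgD; exact: cvgM.
apply: cvgM; last exact: cvg_cst.
by apply: cvgD => //; exact: cvg_norm.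
Qed.

Let cfst : joint_continuous (fun x y : R => x).
Proof. by move=> z; exact: cvg_fst. Qed.

Let csnd : joint_continuous (fun x y : R => y).
Proof. by move=> z; exact: cvg_snd. Qed.

Let M := penalty_weight R1 a.

Lemma penalized_continuous : joint_continuous (penalized V R1 a).
Proof.
move=> z; apply: cvgD; first exact: cV.
apply: cvgM; first exact: cvg_cst.
rewrite expr2; under eq_fun do rewrite expr2.
by apply: cvgM; apply: excess_cvg; [exact: cfst|exact: csnd|exact: cfst|exact: csnd].
Qed.

Lemma penalized1_continuous : joint_continuous (penalized1 V1 R1 a).
Proof.
move=> z; apply: cvgD; first exact: cV1.
apply: cvgM; last exact: cfst.
apply: cvgM; first exact: cvg_cst.
by apply: excess_cvg; [exact: cfst|exact: csnd].
Qed.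

Lemma penalized2_continuous : joint_continuous (penalized2 V2 R1 a).
Proof.
move=> z; apply: cvgD; first exact: cV2.
apply: cvgM; last exact: csnd.
apply: cvgM; first exact: cvg_cst.
by apply: excess_cvg; [exact: cfst|exact: csnd].
Qed.

Lemma penalized_der1 (u v : R) :
  is_derive u 1 (penalized V R1 a ^~ v) (penalized1 V1 R1 a u v).
Proof.
have dk : is_derive u 1 (fun w => w ^+ 2 + v ^+ 2 - R1 ^+ 2) (2 * u).
  apply: is_derive_eq (derB (derD (derX2 (derI u)) (derC (v ^+ 2) u)) (derC (R1 ^+ 2) u)) _.
  by ring.
have de := @is_derive1_comp R (fun k => pospart k ^+ 2)
  (fun w => w ^+ 2 + v ^+ 2 - R1 ^+ 2) u _ _ (der_pospart2 _) dk.
apply: is_derive_eq (derD (dV1 u v) (derM (derC M u) de)) _.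
by rewrite /penalized1 /excess /M; ring.
Qed.

Lemma penalized_der2 (u v : R) :
  is_derive v 1 (penalized V R1 a u) (penalized2 V2 R1 a u v).
Proof.
have dk : is_derive v 1 (fun w => u ^+ 2 + w ^+ 2 - R1 ^+ 2) (2 * v).
  apply: is_derive_eq (derB (derD (derC (u ^+ 2) v) (derX2 (derI v))) (derC (R1 ^+ 2) v)) _.
  by ring.
have de := @is_derive1_comp R (fun k => pospart k ^+ 2)
  (fun w => u ^+ 2 + w ^+ 2 - R1 ^+ 2) v _ _ (der_pospart2 _) dk.
apply: is_derive_eq (derD (dV2 u v) (derM (derC M v) de)) _.
by rewrite /penalized2 /excess /M; ring.
Qed.

Lemma penalized_ge0 u v : 0 <= penalized V R1 a u v.
Proof. by rewrite addr_ge0// mulr_ge0 ?sqr_ge0// divr_ge0 ?exprn_ge0 ?ltW. Qed.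

Lemma chord_in_disk (a1 a2 b1 b2 : R) :
  a1 ^+ 2 + a2 ^+ 2 <= R1 ^+ 2 -> b1 ^+ 2 + b2 ^+ 2 <= R1 ^+ 2 ->
  exists (T : R) (x y p q : R -> R),
    [/\ hamilton_flow V1 V2 T x y p q,
        [/\ x 0 = a1, y 0 = a2, x 1 = b1 & y 1 = b2],
        [/\ continuous x, continuous y, continuous p & continuous q],
        forall t, 0 <= t <= 1 -> energy V (x t) (y t) (p t) (q t) = c &
        forall t, 0 <= t <= 1 -> x t ^+ 2 + y t ^+ 2 <= R1 ^+ 2].
Proof.
move=> aR bR.
have [d0|] := ltP 0 (`|b1 - a1| + `|b2 - a2|); last first.
  move=> d0.
  have e1 : b1 = a1.
    by apply/eqP; rewrite -subr_eq0 -normr_le0; have := normr_ge0 (b2 - a2); lra.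
  have e2 : b2 = a2.
    by apply/eqP; rewrite -subr_eq0 -normr_le0; have := normr_ge0 (b1 - a1); lra.
  (* Equal end points: with [T = 0] any constant curve solves the equations. The momentum is taken
     with p + y = r and q - x = 0, and [r] is fixed by the energy level. *)
  have [r rE] : exists r, r = Num.sqrt (2 * (c + V a1 a2) + a1 ^+ 2 + a2 ^+ 2) by eexists.
  have r2 : r ^+ 2 = 2 * (c + V a1 a2) + a1 ^+ 2 + a2 ^+ 2.
    by rewrite rE sqr_sqrtr// !addr_ge0 ?sqr_ge0// mulr_ge0// addr_ge0// ltW.
  exists 0, (fun=> a1), (fun=> a2), (fun=> r - a2), (fun=> a1); split => //.
  - by move=> t _; rewrite !mul0r; split; exact: derC.
  - by split; move=> t; exact: cvg_cst.
  - by move=> t _; rewrite /energy; move: r2; lra.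
have [T [x [y [p [q [[T0 flow] [x0 y0 x1 y1] [cx cy cp cq] en]]]]]] :=
  connecting_orbit penalized_continuous penalized1_continuous penalized2_continuous
    penalized_der1 penalized_der2 penalized_ge0 c_gt0 d0.
(* The limit retains only [0 <= T]; if [T] were 0, the curve would be constant and could not join
   distinct points. *)
have T_gt0 : 0 < T.
  rewrite lt_neqAle T0 andbT; apply/negP => /eqP T00; move: d0.
  have const (f : R -> R) : continuous f ->
      (forall t : R, 0 < t < 1 -> exists r, is_derive t 1 f (T * r)) -> f 1 = f 0.
    move=> cf df; apply/eqP; rewrite -subr_eq0.
    have [||r _ ->] := @MVT_segment R f (fun=> 0) 0 1 ler01.
    - by move=> t; rewrite in_itv/= => /df[r]; rewrite -T00 mul0r.
    - exact: continuous_subspaceT.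
    by rewrite mul0r.
  have ex : x 1 = x 0 by apply: const => // t /flow[? _ _ _]; eexists; eassumption.
  have ey : y 1 = y 0 by apply: const => // t /flow[_ ? _ _]; eexists; eassumption.
  by rewrite -x0 -y0 -x1 -y1 ex ey !subrr normr0 addr0 ltxx.
have disk01 := orbit_in_disk R1_gt0 a_gt0 c_gt0 c_large V_decay V_radial T_gt0 flow cx cy en.
rewrite x0 y0 x1 y1 in disk01; have {}disk01 := disk01 aR bR.
exists T, x, y, p, q; split => //.
- move=> t t01; have [dx dy dp dq] := flow t t01.
  have t01' : 0 <= t <= 1 by move/andP: t01 => [? ?]; rewrite !ltW.
  have := excess_disk (disk01 t t01') => e0.
  by rewrite /penalized1 /penalized2 e0 !(mulr0, mul0r) !addr0 in dp dq.
- move=> t t01; rewrite -(en t t01) /energy /penalized.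
  by rewrite (excess_disk (disk01 t t01)) expr0n mulr0 addr0.
Qed.

End ChordInDisk.

(** * Weak derivatives of classical curves *)

Section WeakDerivatives.
Context {R : realType}.
Local Notation mu := (@lebesgue_measure R).

Lemma continuous_integrable01 (u : R -> R) : continuous u ->
  mu.-integrable `[0, 1] (EFin \o u).
Proof.
move=> cu; apply: continuous_compact_integrable; first exact: segment_compact.
exact: continuous_subspaceT.
Qed.

Lemma continuous_L2_01 (u : R -> R) : continuous u -> L2_01 u.
Proof.
move=> cu; rewrite /L2_01 inE/=; apply/andP; split; rewrite inE/=.
  apply: (measurable_restrictT u (measurable_itv `[0, 1])).1.
  apply: measurable_funTS.
  exact: continuous_measurable_fun.
rewrite /finite_norm unlock poweR_lty//.
have cu2 : continuous (fun x => u x ^+ 2).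
  have -> : (fun x => u x ^+ 2) = (fun x => u x * u x) by apply/funext => x; rewrite expr2.
  by move=> x; apply: cvgM; exact: cu.
rewrite (_ : (\int[mu]_x _)%E = (\int[mu]_(x in `[0%R, 1%R]) (u x ^+ 2)%:E)%E).
  by have /integrable_lty := continuous_integrable01 cu2; apply.
rewrite [RHS]integral_mkcond; apply: eq_integral => x _ /=.
rewrite !patchE; case: ifPn => _ /=.
  by rewrite powR_mulrn// real_normK ?num_real.
by rewrite normr0 powR0.
Qed.

Lemma continuous_locally_integrable01 (u : R -> R) : continuous u ->
  locally_integrable `]0, 1[ u.
Proof.
move=> cu; apply: open_integrable_locally; first exact: interval_open.
apply: integrableS (continuous_integrable01 cu) => //.
exact: subset_itv_oo_cc.
Qed.

Lemma Rintegral01_oc (f : R -> R) : continuous f ->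
  (\int[mu]_(t in `]0%R, 1%R[) f t)%R = (\int[mu]_(t in `[0%R, 1%R]) f t)%R.
Proof.
move=> cf; rewrite /Rintegral [in RHS]integral_itv_bndoo//.
by apply/measurable_EFinP; apply: measurable_funTS; exact: continuous_measurable_fun.
Qed.

Lemma test_function_boundary (phi : R -> R) : test_function phi ->
  phi 0 = 0 /\ phi 1 = 0.
Proof.
move=> [_ supp].
have vanish (t : R) : ~ `]0%R, 1%R[%classic t -> phi t = 0.
  move=> t01; apply: contrapT => /eqP pt; apply: t01; apply: supp.
  exact: subset_closure.
by split; apply: vanish; rewrite /= in_itv/= ltxx ?andbF.
Qed.

(** Integration by parts, whose boundary terms vanish because a test function is 0 at both end
    points. *)
Lemma classical_weak_derivative (u w : R -> R) : continuous u -> continuous w ->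
  (forall t : R, 0 < t < 1 -> is_derive t 1 u (w t)) -> weak_derivative u w.
Proof.
move=> cu cw uw; split; [exact: continuous_locally_integrable01
  |exact: continuous_locally_integrable01|].
move=> phi tphi; have [phi0 phi1] := test_function_boundary tphi.
have [dphi _] := tphi.
have der_cont (f : R -> R) : (forall t, derivable f t 1) -> continuous f.
  by move=> df t; apply/differentiable_continuous; rewrite -derivable1_diffP.
have cphi : continuous phi by apply: der_cont => t; exact: (dphi 0%N).
have cdphi : continuous (derive1 phi) by apply: der_cont => t; exact: (dphi 1%N).
have LR (f : R -> R) : continuous f -> (forall t : R, 0 < t < 1 -> derivable f t 1) ->
    derivable_oo_LRcontinuous f 0 1.
  move=> cf df; split.
  - by move=> t; rewrite in_itv/=; exact: df.
  - by apply: cvg_at_right_filter; exact: cf.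
  - by apply: cvg_at_left_filter; exact: cf.
rewrite !Rintegral01_oc; last 2 first.
  by move=> t; apply: cvgM; [exact: cw|exact: cphi].
  by move=> t; apply: cvgM; [exact: cu|exact: cdphi].
rewrite (@Rintegration_by_parts R u phi w (derive1 phi) 0 1 ltr01).
- by rewrite phi0 phi1 !mulr0 subrr sub0r.
- exact: continuous_subspaceT.
- by apply: LR => // t /uw[].
- by move=> t; rewrite in_itv/= => /uw[_ e]; rewrite derive1E.
- exact: continuous_subspaceT.
- by apply: LR => // t _; exact: (dphi 0%N).
- by [].
Qed.

Lemma classical_W12_01 (u w : R -> R) : continuous u -> continuous w ->
  (forall t : R, 0 < t < 1 -> is_derive t 1 u (w t)) -> W12_01 u.
Proof.
move=> cu cw uw; split; [exact: continuous_subspaceT|exact: continuous_L2_01|].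
by exists w; split; [exact: continuous_L2_01|exact: classical_weak_derivative].
Qed.

End WeakDerivatives.

(** * Cartesian and polar coordinates *)

Section PlaneCoordinates.
Context {R : realType}.

Definition planept (x y : R) : plane R := \row_(i < 2) (if i == 0 then x else y).

Lemma planept0 x y : planept x y 0 0 = x.
Proof. by rewrite mxE. Qed.

Lemma planept1 x y : planept x y 0 1 = y.
Proof. by rewrite mxE. Qed.

Lemma planeptE (v : plane R) : v = planept (v 0 0) (v 0 1).
Proof.
apply/rowP => i; rewrite mxE; case: eqP => [->//|/eqP i0].
by congr (v _ _); apply/val_inj; case: i i0 => [[|[|]]].
Qed.

Lemma planept_shift0 h x y : h *: unit_vec 0 + planept x y = planept (h + x) y.
Proof.
by rewrite [LHS]planeptE !mxE/= mulr1 mulr0 add0r.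
Qed.

Lemma planept_shift1 h x y : h *: unit_vec 1 + planept x y = planept x (h + y).
Proof.
by rewrite [LHS]planeptE !mxE/= mulr1 mulr0 add0r.
Qed.

Lemma planept_continuous : continuous (fun z : R * R => planept z.1 z.2).
Proof.
have -> : (fun z : R * R => planept z.1 z.2) =
    (fun z => z.1 *: (unit_vec 0 : plane R) + z.2 *: (unit_vec 1 : plane R)).
  apply/funext => z; rewrite [RHS]planeptE !mxE/=.
  by rewrite !(mulr1, mulr0) add0r addr0.
move=> z; apply: cvgD; apply: cvgZr_tmp; [exact: cvg_fst|exact: cvg_snd].
Qed.

Variable V : plane R -> R.
Hypothesis smV : smooth_plane V.

Definition cart (x y : R) : R := V (planept x y).
Definition cart1 (x y : R) : R := 'D_(unit_vec 0) V (planept x y).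
Definition cart2 (x y : R) : R := 'D_(unit_vec 1) V (planept x y).

Lemma cart_continuous : joint_continuous cart.
Proof.
move=> z; apply: (@continuous_comp _ _ _
  (fun z : R * R => planept z.1 z.2) V z).
  exact: planept_continuous.
by have [+ _] := smV [::]; apply.
Qed.

Lemma cart1_continuous : joint_continuous cart1.
Proof.
move=> z; apply: (@continuous_comp _ _ _
  (fun z : R * R => planept z.1 z.2) ('D_(unit_vec 0) V) z).
  exact: planept_continuous.
by have [+ _] := smV [:: 0]; apply.
Qed.

Lemma cart2_continuous : joint_continuous cart2.
Proof.
move=> z; apply: (@continuous_comp _ _ _
  (fun z : R * R => planept z.1 z.2) ('D_(unit_vec 1) V) z).
  exact: planept_continuous.
by have [+ _] := smV [:: 1]; apply.
Qed.

Lemma cart_der1 (u v : R) : is_derive u 1 (cart ^~ v) (cart1 u v).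
Proof.
have [_ /(_ 0 (planept u v))] := smV [::] => dV.
apply/is_derive_cvg; move: dV; rewrite /derivable /cart1 /derive /=.
by under eq_fun do rewrite planept_shift0.
Qed.

Lemma cart_der2 (u v : R) : is_derive v 1 (cart u) (cart2 u v).
Proof.
have [_ /(_ 1 (planept u v))] := smV [::] => dV.
apply/is_derive_cvg; move: dV; rewrite /derivable /cart2 /derive /=.
by under eq_fun do rewrite planept_shift1.
Qed.

(** Reduces each component of [ham_vf] to one-variable calculus along a line. *)
Lemma derive_line (U : normedModType R) (f : U -> R) (x v : U) (l : R) :
  is_derive (0 : R) 1 (fun h : R => f (h *: v + x)) l -> 'D_v f x = l.
Proof.
move=> /is_derive_cvg H; rewrite /derive; apply: cvg_lim => //.
by move: H; under eq_fun do rewrite addr0 scale0r add0r.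
Qed.

Lemma hamiltonian_planept x y p q :
  hamiltonian V (planept x y, planept p q) = (p ^+ 2 + q ^+ 2) / 2 + p * y - q * x - cart x y.
Proof. by rewrite /hamiltonian !planept0 !planept1 /cart; ring. Qed.

Lemma ham_vf_planept x y p q : ham_vf (hamiltonian V) (planept x y, planept p q) =
  (planept (p + y) (q - x), planept (q + cart1 x y) (- p + cart2 x y)).
Proof.
have shift (h : R) (u v w z : plane R) : h *: (u, v) + (w, z) = (h *: u + w, h *: v + z) by [].
have dh (a : R) : is_derive (0 : R) 1 (fun h => h + a) 1.
  by apply: is_derive_eq (derD (derI 0) (derC a 0)) _; rewrite addr0.
rewrite /ham_vf; congr pair; rewrite [LHS]planeptE !mxE; congr planept.
- apply: derive_line.
  under eq_fun do rewrite shift scaler0 add0r planept_shift0 hamiltonian_planept.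
  have D := derB (derB (derD (derM (derD (derX2 (dh p)) (derC (q ^+ 2) 0)) (derC 2^-1 0))
    (derM (dh p) (derC y 0))) (derC (q * x) 0)) (derC (cart x y) 0).
  by apply: is_derive_eq D _; field.
- apply: derive_line.
  under eq_fun do rewrite shift scaler0 add0r planept_shift1 hamiltonian_planept.
  have D := derB (derB (derD (derM (derD (derC (p ^+ 2) 0) (derX2 (dh q))) (derC 2^-1 0))
    (derC (p * y) 0)) (derM (dh q) (derC x 0))) (derC (cart x y) 0).
  by apply: is_derive_eq D _; field.
- apply/eqP; rewrite eqr_oppLR; apply/eqP; apply: derive_line.
  under eq_fun do rewrite shift scaler0 add0r planept_shift0 hamiltonian_planept.
  have Dc : is_derive (0 : R) 1 (fun h => cart (h + x) y) (cart1 x y).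
    have := @is_derive1_comp R (cart ^~ y) (fun h => h + x) 0 (cart1 x y) 1.
    by rewrite add0r mulr1; apply; exact: cart_der1.
  have D := derB (derB (derC ((p ^+ 2 + q ^+ 2) / 2 + p * y) 0) (derM (derC q 0) (dh x))) Dc.
  by apply: is_derive_eq D _; ring.
- apply/eqP; rewrite eqr_oppLR; apply/eqP; apply: derive_line.
  under eq_fun do rewrite shift scaler0 add0r planept_shift1 hamiltonian_planept.
  have Dc : is_derive (0 : R) 1 (fun h => cart x (h + y)) (cart2 x y).
    have := @is_derive1_comp R (cart x) (fun h => h + y) 0 (cart2 x y) 1.
    by rewrite add0r mulr1; apply; exact: cart_der2.
  have D := derB (derB (derD (derC ((p ^+ 2 + q ^+ 2) / 2) 0) (derM (derC p 0) (dh y)))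
    (derC (q * x) 0)) Dc.
  by apply: is_derive_eq D _; ring.
Qed.

Lemma polar_angle (u v : R) : u ^+ 2 + v ^+ 2 = 1 ->
  exists theta : R, cos theta = u /\ sin theta = v.
Proof.
move=> uv; have u1 : -1 <= u <= 1.
  by have v2 := sqr_ge0 v; apply/andP; split; nra.
have [v0|v0] := leP 0 v.
  exists (acos u); rewrite acosK ?in_itv//; split=> //.
  by rewrite sin_acos// (_ : 1 - u ^+ 2 = v ^+ 2) ?sqrtr_sqr ?ger0_norm//; lra.
exists (- acos u); rewrite cosN sinN acosK ?in_itv//; split=> //.
by rewrite sin_acos// (_ : 1 - u ^+ 2 = v ^+ 2) ?sqrtr_sqr ?ltr0_norm ?opprK//; lra.
Qed.

Lemma polar_coordinates (r1 x y : R) : 0 < r1 -> r1 ^+ 2 < x ^+ 2 + y ^+ 2 ->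
  exists r theta : R, [/\ r1 < r, r = Num.sqrt (x ^+ 2 + y ^+ 2),
    x = r * cos theta & y = r * sin theta].
Proof.
move=> r10 xy; have s0 : 0 < x ^+ 2 + y ^+ 2 by apply: lt_trans xy; rewrite exprn_gt0.
have [r rE] : exists r, r = Num.sqrt (x ^+ 2 + y ^+ 2) by eexists.
have r0 : 0 < r by rewrite rE sqrtr_gt0.
have r2 : r ^+ 2 = x ^+ 2 + y ^+ 2 by rewrite rE sqr_sqrtr// ltW.
have [|theta [ct st]] := @polar_angle (x / r) (y / r).
  by rewrite !expr_div_n -mulrDl -r2 mulfV// expf_neq0// lt0r_neq0.
exists r, theta; split=> //.
- by rewrite -(@ltr_pXn2r _ 2)// ?nnegrE ?r2// ltW.
- by rewrite ct mulrC divfK// lt0r_neq0.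
- by rewrite st mulrC divfK// lt0r_neq0.
Qed.

Lemma d_r_cart (r theta : R) : d_r V r theta =
  cart1 (r * cos theta) (r * sin theta) * cos theta +
  cart2 (r * cos theta) (r * sin theta) * sin theta.
Proof.
have dl (b : R) : is_derive r 1 (fun s => s * b) b.
  by apply: is_derive_eq (derM (derI r) (derC b r)) _; rewrite mul1r mulr0 addr0.
have := chain_rule2 cart1_continuous cart2_continuous cart_der1 cart_der2
  (dl (cos theta)) (dl (sin theta)).
by move=> [_ <-]; rewrite /d_r derive1E.
Qed.

End PlaneCoordinates.

(** * From polar hypotheses to a Sobolev curve in phase space *)

Theorem theorem1p1 (R : realType) (R1 a : R) (V : plane R -> R)
    (q0 q1 : plane R) (c : R) :
  0 < R1 -> 0 < a ->
  smooth_plane V ->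
  (forall q : plane R, 0 <= V q) ->
  (forall r theta : R, R1 < r -> in_polar V r theta <= a / r) ->
  (forall r theta : R, R1 < r ->
     0 <= d_r V r theta + 2 / r * in_polar V r theta) ->
  enorm q0 <= R1 -> enorm q1 <= R1 ->
  (Num.max (cbrt (32 * a ^+ 2))
           (Num.sqrt (4 * a * (3 * R1 + 2 * cbrt (2 * a)))) < c
   \/
   (Num.sqrt (2 * a * R1) < c /\
    forall r theta : R, R1 <= r -> d_theta V r theta = 0)) ->
  exists (v : R -> phase R) (eta : R),
    [/\ W12_phase v,
        weak_derivative_phase v
          (fun t => eta *: ham_vf (hamiltonian V) (v t)),
        v @` `[0, 1] `<=` hamiltonian V @^-1` [set c],
        cotangent_fiber q0 (v 0) /\ cotangent_fiber q1 (v 1) &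
        v @` `[0, 1] `<=` cotangent (disk R1)].
Proof.
move=> R1_gt0 a_gt0 smV V_ge0 decay radial q0R q1R cond.
have sqrt_lt (X : R) : 0 <= X -> Num.sqrt X < c -> 0 < c /\ X < c ^+ 2.
  move=> X0 Xc; have c0 : 0 < c by apply: le_lt_trans Xc; exact: sqrtr_ge0.
  by split=> //; rewrite -[ltLHS](sqr_sqrtr X0) ltr_pXn2r// nnegrE ?sqrtr_ge0// ltW.
(* In the first case the square root in the maximum gives c^2 > 12 a R1 + 8 a [cbrt (2 * a)], which
   exceeds 2 a R1. *)
have [c_gt0 c_large] : 0 < c /\ 2 * a * R1 < c ^+ 2.
  have aR : 0 < a * R1 by rewrite mulr_gt0.
  case: cond => [|[+ _]]; last by apply: sqrt_lt; rewrite -mulrA mulr_ge0// ltW.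
  rewrite gt_max => /andP[_]; have k0 : 0 <= cbrt (2 * a) := powR_ge0 _ _.
  have ak : 0 <= a * cbrt (2 * a) by rewrite mulr_ge0// ltW.
  by move=> /sqrt_lt[|c0 cl]; [lra|split=> //; lra].
have cartE r theta : in_polar V r theta = cart V (r * cos theta) (r * sin theta) by [].
have cart_decay x y : R1 ^+ 2 < x ^+ 2 + y ^+ 2 ->
    cart V x y <= a / Num.sqrt (x ^+ 2 + y ^+ 2).
  move=> xy; have [r [theta [R1r <- -> ->]]] := polar_coordinates R1_gt0 xy.
  by rewrite -cartE; exact: decay.
have cart_radial x y : R1 ^+ 2 < x ^+ 2 + y ^+ 2 ->
    0 <= x * cart1 V x y + y * cart2 V x y + 2 * cart V x y.
  move=> xy; have [r [theta [R1r _ -> ->]]] := polar_coordinates R1_gt0 xy.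
  have r0 : 0 < r by apply: lt_trans R1r.
  (* Multiplication by [r] turns r d_r V into [x * cart1 V x y + y * cart2 V x y] and clears the
     denominator of 2 / r. *)
  have := mulr_ge0 (ltW r0) (radial r theta R1r); rewrite d_r_cart// cartE.
  move: (cart V _ _) (cart1 V _ _) (cart2 V _ _) => w w1 w2 /le_trans; apply.
  by rewrite le_eqVlt; apply/orP; left; apply/eqP; field; rewrite lt0r_neq0.
have in_disk (q : plane R) : enorm q <= R1 -> q 0 0 ^+ 2 + q 0 1 ^+ 2 <= R1 ^+ 2.
  move=> qR; rewrite -(@sqr_sqrtr _ (q 0 0 ^+ 2 + q 0 1 ^+ 2)) ?addr_ge0 ?sqr_ge0//.
  by rewrite lerXn2r// nnegrE ?sqrtr_ge0// ltW.
have [T [x [y [p [q [flow [x0 y0 x1 y1] [cx cy cp cq] en disk01]]]]]] :=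
  chord_in_disk (cart_continuous smV) (cart1_continuous smV) (cart2_continuous smV)
    (cart_der1 smV) (cart_der2 smV) (fun u v => V_ge0 (planept u v))
    R1_gt0 a_gt0 c_gt0 c_large cart_decay cart_radial (in_disk _ q0R) (in_disk _ q1R).
have comp_cont (W : R -> R -> R) : joint_continuous W -> continuous (fun t => W (x t) (y t)).
  by move=> cW t; apply: joint_cvg => //; [exact: cx|exact: cy].
have scale_cont (f : R -> R) : continuous f -> continuous (fun t => T * f t).
  by move=> cf t; apply: cvgM; [exact: cvg_cst|exact: cf].
have cdx : continuous (fun t => T * (p t + y t)).
  by apply: scale_cont => t; apply: cvgD; [exact: cp|exact: cy].
have cdy : continuous (fun t => T * (q t - x t)).
  by apply: scale_cont => t; apply: cvgB; [exact: cq|exact: cx].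
have cdp : continuous (fun t => T * (q t + cart1 V (x t) (y t))).
  apply: scale_cont => t; apply: cvgD; first exact: cq.
  exact: comp_cont (cart1_continuous smV) t.
have cdq : continuous (fun t => T * (- p t + cart2 V (x t) (y t))).
  apply: scale_cont => t; apply: cvgD; first by apply: cvgN; exact: cp.
  exact: comp_cont (cart2_continuous smV) t.
have dx t (t01 : 0 < t < 1) := let: And4 d _ _ _ := flow t t01 in d.
have dy t (t01 : 0 < t < 1) := let: And4 _ d _ _ := flow t t01 in d.
have dp t (t01 : 0 < t < 1) := let: And4 _ _ d _ := flow t t01 in d.
have dq t (t01 : 0 < t < 1) := let: And4 _ _ _ d := flow t t01 in d.
pose v t : phase R := (planept (x t) (y t), planept (p t) (q t)).
have ev1 (f g : R -> R) (i : 'I_2) :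
    (fun t => planept (f t) (g t) 0 i) = if i == 0 then f else g.
  by apply/funext => t; rewrite mxE; case: ifP.
have evf i : (fun t => (T *: ham_vf (hamiltonian V) (v t)).1 0 i) =
    if i == 0 then fun t => T * (p t + y t) else fun t => T * (q t - x t).
  by apply/funext => t; rewrite ham_vf_planept// !mxE; case: ifP.
have evs i : (fun t => (T *: ham_vf (hamiltonian V) (v t)).2 0 i) =
    if i == 0 then fun t => T * (q t + cart1 V (x t) (y t))
    else fun t => T * (- p t + cart2 V (x t) (y t)).
  by apply/funext => t; rewrite ham_vf_planept// !mxE; case: ifP.
exists v, T; split.
- move=> i; rewrite !ev1; case: ifP => _; split.
  + exact: classical_W12_01 cx cdx dx.
  + exact: classical_W12_01 cp cdp dp.
  + exact: classical_W12_01 cy cdy dy.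
  + exact: classical_W12_01 cq cdq dq.
- move=> i; rewrite evf evs !ev1; case: ifP => _; split.
  + exact: classical_weak_derivative cx cdx dx.
  + exact: classical_weak_derivative cp cdp dp.
  + exact: classical_weak_derivative cy cdy dy.
  + exact: classical_weak_derivative cq cdq dq.
- move=> _ [t t01 <-]; suff : hamiltonian V (v t) = c by [].
  rewrite hamiltonian_planept; apply: en.
  by move: t01; rewrite /= in_itv.
- by split; rewrite /cotangent_fiber /cotangent /= ?x0 ?y0 ?x1 ?y1 -planeptE.
- move=> _ [t t01 <-]; rewrite /cotangent /disk /= /enorm planept0 planept1.
  rewrite -(@ler_pXn2r _ 2)// ?nnegrE ?sqrtr_ge0 ?(ltW R1_gt0)//.
  rewrite sqr_sqrtr ?addr_ge0 ?sqr_ge0//; apply: disk01.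
  by move: t01; rewrite /= in_itv.
Qed.
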